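(* There exists a polynomial time algorithm which, given an $\mathsf{NJp}$-derivation $d$ of a sequent $\Gamma\Rightarrow\alpha_0\lor\alpha_1$ with a Harrop antecedent $\Gamma$, outputs an $i\in\{0,1\}$ together with a $(cut)$-deduction, from the set of sequents occurring in $d$, of a sequent $\Gamma'\Rightarrow\alpha_i$ with $\Gamma'\subseteq\Gamma$.
   Context: Formulas are propositional formulas built from atoms and $\bot$ with $\lor,\land,\supset$; a cedent is a finite set of formulas, a sequent $\Gamma\Rightarrow\alpha$ pairs a cedent with a formula. $\mathsf{NJp}$ (natural deduction for intuitionistic propositional logic) has axioms $\alpha,\Gamma\Rightarrow\alpha$ and $\bot,\Gamma\Rightarrow p$ ($p$ atom) and rules $(\lor E)$: from $\Gamma\Rightarrow\alpha_0\lor\alpha_1$, $\alpha_0,\Gamma\Rightarrow\beta$, $\alpha_1,\Gamma\Rightarrow\beta$ infer $\Gamma\Rightarrow\beta$; $(\lor I)$: from $\Gamma\Rightarrow\alpha_i$ infer $\Gamma\Rightarrow\alpha_0\lor\alpha_1$; $(\land E)$: from $\Gamma\Rightarrow\alpha_0\land\alpha_1$ infer $\Gamma\Rightarrow\alpha_i$; $(\land I)$: from $\Gamma\Rightarrow\alpha_0$, $\Gamma\Rightarrow\alpha_1$ infer $\Gamma\Rightarrow\alpha_0\land\alpha_1$; $(\supset E)$: from $\Gamma\Rightarrow\alpha\supset\beta$, $\Gamma\Rightarrow\alpha$ infer $\Gamma\Rightarrow\beta$; $(\supset I)$: from $\alpha,\Gamma\Rightarrow\beta$ infer $\Gamma\Rightarrow\alpha\supset\beta$.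 An occurrence of a subformula is strictly positive in $\alpha$ if it is $\alpha$ itself, or $\alpha$ is $\alpha_0\lor\alpha_1$ or $\alpha_0\land\alpha_1$ and it is strictly positive in some $\alpha_i$, or $\alpha$ is $\alpha_0\supset\alpha_1$ and it is strictly positive in $\alpha_1$. A Harrop formula has no strictly positive occurrence of a disjunction; a Harrop cedent consists of Harrop formulas. A $(cut)$-deduction from a set $\mathcal{S}$ of sequents is a finite tree of sequents whose leaves belong to $\mathcal{S}$ and all of whose inferences are $(cut)$: from $\Gamma\Rightarrow\beta$ and $\beta,\Delta\Rightarrow\alpha$ infer $\Gamma,\Delta\Rightarrow\alpha$ (formulas being treated as unanalyzed objects). *)

(* Defs.v *)
From HB Require Import structures.
From mathcomp Require Import all_boot.
From mathcomp Require Import finmap.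

Set Implicit Arguments.
Unset Strict Implicit.
Unset Printing Implicit Defensive.

Local Open Scope fset_scope.

(* Atoms are named by arbitrary bit strings: countably many atoms, whose names
   are written out in full in the encodings below. *)
Inductive formula : Type :=
| Atom of seq bool
| Bot
| Or of formula & formula
| And of formula & formula
| Imp of formula & formula.

Fixpoint formula_to_gentree (a : formula) : GenTree.tree (seq bool) :=
  match a with
  | Atom x => GenTree.Leaf x
  | Bot => GenTree.Node 0 [::]
  | Or a b => GenTree.Node 1 [:: formula_to_gentree a; formula_to_gentree b]
  | And a b => GenTree.Node 2 [:: formula_to_gentree a; formula_to_gentree b]
  | Imp a b => GenTree.Node 3 [:: formula_to_gentree a; formula_to_gentree b]
  end.

Fixpoint formula_of_gentree (t : GenTree.tree (seq bool)) : option formula :=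
  match t with
  | GenTree.Leaf x => Some (Atom x)
  | GenTree.Node 1 [:: t; u] =>
      obind (fun a => omap (Or a) (formula_of_gentree u))
        (formula_of_gentree t)
  | GenTree.Node 2 [:: t; u] =>
      obind (fun a => omap (And a) (formula_of_gentree u))
        (formula_of_gentree t)
  | GenTree.Node 3 [:: t; u] =>
      obind (fun a => omap (Imp a) (formula_of_gentree u))
        (formula_of_gentree t)
  | GenTree.Node _ _ => Some Bot
  end.

Lemma formula_gentreeK : pcancel formula_to_gentree formula_of_gentree.
Proof.
by elim=> [x||a IHa b IHb|a IHa b IHb|a IHa b IHb] //=; rewrite IHa IHb.
Qed.

HB.instance Definition _ := Countable.copy formula (pcan_type formula_gentreeK).

Definition cedent := {fset formula}.
Definition sequent : Type := (cedent * formula)%type.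

(* [strictly_positive b a]: some occurrence of [b] in [a] is strictly positive. *)
Inductive strictly_positive (b : formula) : formula -> Prop :=
| SP_refl : strictly_positive b b
| SP_orl a0 a1 : strictly_positive b a0 -> strictly_positive b (Or a0 a1)
| SP_orr a0 a1 : strictly_positive b a1 -> strictly_positive b (Or a0 a1)
| SP_andl a0 a1 : strictly_positive b a0 -> strictly_positive b (And a0 a1)
| SP_andr a0 a1 : strictly_positive b a1 -> strictly_positive b (And a0 a1)
| SP_impr a0 a1 : strictly_positive b a1 -> strictly_positive b (Imp a0 a1).

Definition harrop (a : formula) : Prop :=
  forall b0 b1 : formula, ~ strictly_positive (Or b0 b1) a.

Definition harrop_cedent (G : cedent) : Prop :=
  forall a : formula, a \in G -> harrop a.

Inductive tree (A : Type) : Type := Node of A & seq (tree A).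

Definition tree_root A (t : tree A) : A := let: Node x _ := t in x.

Fixpoint tree_labels A (t : tree A) : seq A :=
  let: Node x ts := t in x :: flatten (map (@tree_labels A) ts).

Fixpoint tree_map A B (f : A -> B) (t : tree A) : tree B :=
  let: Node x ts := t in Node (f x) (map (tree_map f) ts).

Inductive NJp : tree sequent -> Prop :=
| NJp_ax (G : cedent) a : NJp (Node (a |` G, a) [::])
| NJp_bot (G : cedent) p : NJp (Node (Bot |` G, Atom p) [::])
| NJp_orE (G : cedent) a0 a1 b t t0 t1 :
    NJp t -> NJp t0 -> NJp t1 ->
    tree_root t = (G, Or a0 a1) ->
    tree_root t0 = (a0 |` G, b) -> tree_root t1 = (a1 |` G, b) ->
    NJp (Node (G, b) [:: t; t0; t1])
| NJp_orIl (G : cedent) a0 a1 t :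
    NJp t -> tree_root t = (G, a0) -> NJp (Node (G, Or a0 a1) [:: t])
| NJp_orIr (G : cedent) a0 a1 t :
    NJp t -> tree_root t = (G, a1) -> NJp (Node (G, Or a0 a1) [:: t])
| NJp_andEl (G : cedent) a0 a1 t :
    NJp t -> tree_root t = (G, And a0 a1) -> NJp (Node (G, a0) [:: t])
| NJp_andEr (G : cedent) a0 a1 t :
    NJp t -> tree_root t = (G, And a0 a1) -> NJp (Node (G, a1) [:: t])
| NJp_andI (G : cedent) a0 a1 t0 t1 :
    NJp t0 -> NJp t1 -> tree_root t0 = (G, a0) -> tree_root t1 = (G, a1) ->
    NJp (Node (G, And a0 a1) [:: t0; t1])
| NJp_impE (G : cedent) a b t0 t1 :
    NJp t0 -> NJp t1 -> tree_root t0 = (G, Imp a b) -> tree_root t1 = (G, a) ->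
    NJp (Node (G, b) [:: t0; t1])
| NJp_impI (G : cedent) a b t :
    NJp t -> tree_root t = (a |` G, b) -> NJp (Node (G, Imp a b) [:: t]).

Inductive cut_deduction (S : seq sequent) : tree sequent -> Prop :=
| CD_leaf s : s \in S -> cut_deduction S (Node s [::])
| CD_cut (G D : cedent) b a t0 t1 :
    cut_deduction S t0 -> cut_deduction S t1 ->
    tree_root t0 = (G, b) -> tree_root t1 = (b |` D, a) ->
    cut_deduction S (Node (G `|` D, a) [:: t0; t1]).

Inductive token : Type :=
| TBit of bool | TAtom | TEnd | TBot | TOr | TAnd | TImp
| TComma | TArrow | TOpen | TClose.

Definition token_code (x : token) : option bool + 'I_9 :=
  match x with
  | TBit b => inl (Some b)
  | TAtom => inl None
  | TEnd => inr (inord 0)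
  | TBot => inr (inord 1)
  | TOr => inr (inord 2)
  | TAnd => inr (inord 3)
  | TImp => inr (inord 4)
  | TComma => inr (inord 5)
  | TArrow => inr (inord 6)
  | TOpen => inr (inord 7)
  | TClose => inr (inord 8)
  end.

Definition token_decode (c : option bool + 'I_9) : token :=
  match c with
  | inl (Some b) => TBit b
  | inl None => TAtom
  | inr i => nth TClose [:: TEnd; TBot; TOr; TAnd; TImp; TComma; TArrow; TOpen] i
  end.

Lemma token_codeK : cancel token_code token_decode.
Proof. by case=> //=; rewrite inordK. Qed.

HB.instance Definition _ := Finite.copy token (can_type token_codeK).

Fixpoint encode_formula (a : formula) : seq token :=
  match a with
  | Atom x => TAtom :: map TBit x ++ [:: TEnd]
  | Bot => [:: TBot]
  | Or a b => TOr :: encode_formula a ++ encode_formula b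
  | And a b => TAnd :: encode_formula a ++ encode_formula b
  | Imp a b => TImp :: encode_formula a ++ encode_formula b
  end.

Definition encode_sequent (s : seq formula * formula) : seq token :=
  flatten [seq TComma :: encode_formula a | a <- s.1]
    ++ TArrow :: encode_formula s.2.

Fixpoint encode_tree (t : tree (seq formula * formula)) : seq token :=
  let: Node s ts := t in
  TOpen :: encode_sequent s ++ flatten (map encode_tree ts) ++ [:: TClose].

(* A cedent is a finite set, but is written as a list of its elements, in any
   order and possibly with repetitions.  Hence a tree of sequents has several
   encodings, and being one of them is a relation. *)
Definition sequent_of (s : seq formula * formula) : sequent :=
  ([fset a in s.1], s.2).

Definition tree_encoding (t : tree sequent) (w : seq token) : Prop :=
  exists2 u : tree (seq formula * formula),
    tree_map sequent_of u = t & w = encode_tree u.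

Definition answer_encoding (i : bool) (t : tree sequent) (v : seq token) : Prop :=
  exists2 w : seq token, tree_encoding t w & v = TBit i :: w.

Inductive move : Type := MoveLeft | Stay | MoveRight.

(* Tape symbols: [None] is the blank, [Some (inl x)] a symbol of the
   input/output alphabet, [Some (inr y)] an auxiliary symbol.  There are
   [tm_extra.+1] tapes. *)
Record turing_machine (Sigma : finType) : Type := TuringMachine {
  tm_state : finType;
  tm_aux : finType;
  tm_extra : nat;
  tm_start : tm_state;
  tm_halting : pred tm_state;
  tm_delta :
    tm_state -> {ffun 'I_tm_extra.+1 -> option (Sigma + tm_aux)} ->
    tm_state * ('I_tm_extra.+1 -> option (Sigma + tm_aux) * move)
}.

Section Run.
Variables (Sigma : finType) (M : turing_machine Sigma).

Local Notation symb := (option (Sigma + tm_aux M)).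
Local Notation tape_index := 'I_(tm_extra M).+1.

(* [(l, r)] is the two-way infinite tape with contents [rev l ++ r], all other
   cells being blank, and the head on the first cell of [r]. *)
Definition tape : Type := (seq symb * seq symb)%type.

Definition tape_read (t : tape) : symb := head None t.2.

Definition tape_write (x : symb) (t : tape) : tape := (t.1, x :: behead t.2).

Definition tape_move (m : move) (t : tape) : tape :=
  match m with
  | MoveLeft => (behead t.1, head None t.1 :: t.2)
  | Stay => t
  | MoveRight => (head None t.2 :: t.1, behead t.2)
  end.

Definition config : Type := (tm_state M * (tape_index -> tape))%type.

Definition tm_init (w : seq Sigma) : config :=
  (tm_start M,
   fun j => if j == ord0 then ([::], [seq Some (inl x) | x <- w])
            else ([::], [::])).

Definition tm_step (c : config) : config :=
  if tm_halting c.1 then c else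
  let: (q, act) := tm_delta c.1 [ffun j => tape_read (c.2 j)] in
  (q, fun j => tape_move (act j).2 (tape_write (act j).1 (c.2 j))).

Fixpoint word_prefix (r : seq symb) : seq Sigma :=
  match r with
  | Some (inl x) :: r' => x :: word_prefix r'
  | _ => [::]
  end.

(* The output is read on the first tape, from the head rightwards up to the
   first cell that holds no symbol of [Sigma]. *)
Definition tm_output (c : config) : seq Sigma := word_prefix (c.2 ord0).2.

Definition tm_computes_within (w v : seq Sigma) (n : nat) : Prop :=
  exists2 m : nat, m <= n &
    let c := iter m tm_step (tm_init w) in tm_halting c.1 /\ tm_output c = v.

End Run.

(* Main.v *)
Require Import Defs.
From HB Require Import structures.
From mathcomp Require Import all_boot ssralg poly.
From mathcomp Require Import finmap.
From mathcomp Require Import zify.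

(* Let [U] be the least set of formulas containing the succedent of a sequent
   of [d] as soon as the antecedent lies in the union of [G] and [U].  An
   Aczel slash, in which provability is replaced by membership in [U] and
   assumability by membership in the union of [G] and [U], is preserved by the
   rules of NJp and holds of all Harrop formulas; hence one of the disjuncts
   of the end sequent is in [U].

   The set [U] is computed by forward chaining, logging the sequents that fire.
   Reading the log backwards from the sequent that yields the disjunct, and
   cutting whenever the succedent read occurs in the current antecedent, gives
   a deduction in which every left premise is a leaf, hence of polynomial size.

   On the machine, rounds of forward chaining are a single pass over the list
   of all sequents of [d] repeated sufficiently often.  The tapes are used as
   stacks of delimited words.  Words are only compared and copied, except that
   the disjunction is split once, so no word is ever longer than the input, and
   it suffices to count the operations on words. *)

Set Implicit Arguments.
Unset Strict Implicit.
Unset Printing Implicit Defensive.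

Local Open Scope fset_scope.
Local Open Scope nat_scope.

(** * Machines *)

(** The requirement that the final antecedent stay inside [G] is what makes the log chronological:
    the hypotheses of a logged sequent lie in [G] or among succedents logged earlier. A cut made
    while reading backwards thus replaces a formula by formulas supported by strictly older entries,
    and only members of [G] survive the end of the log. Repeated firing of a sequent is not
    prevented; as many passes as there are sequents suffice, since a pass that starts unsaturated
    supplies the succedent of a further sequent.

    The slash is true at atoms and at [Bot]: a Harrop antecedent may contain [Bot], and the axiom
    for [Bot] concludes only atoms.

    On the machine, the obstacle is that tapes grow long while the cost of an operation should
    depend on a single word. Hence a register is accessed at its top only, popped material is left
    behind as garbage beyond the head, and tapes are compared up to padding by blanks. The running
    time has degree 6: degree 5 for the number of word operations, and one more for the length of a
    word. *)

Notation cell := (option (token + void)).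
Notation reg := 'I_13.
Definition ztape : Type := (seq cell * seq cell)%type.
Definition conf : Type := reg -> ztape.
Definition reading : Type := {ffun reg -> cell}.

Definition read_all (c : conf) : reading := [ffun j => head None (c j).2].

Definition act1 (x : cell * move) (t : ztape) : ztape :=
  match x.2 with
  | MoveLeft => (behead t.1, head None t.1 :: x.1 :: behead t.2)
  | Stay => (t.1, x.1 :: behead t.2)
  | MoveRight => (x.1 :: t.1, behead t.2)
  end.

Definition act (f : reg -> cell * move) (c : conf) : conf :=
  fun j => act1 (f j) (c j).

(* Equality of tapes whose ends are padded with infinitely many blanks. *)
Definition blank_eq (s1 s2 : seq cell) : Prop := nth None s1 =1 nth None s2.
Definition teq (t u : ztape) : Prop := blank_eq t.1 u.1 /\ blank_eq t.2 u.2.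
Definition ceq (c d : conf) : Prop := forall j, teq (c j) (d j).

Lemma blank_eq_cons x s1 s2 : blank_eq s1 s2 -> blank_eq (x :: s1) (x :: s2).
Proof. by move=> e [|i] //=; apply: e. Qed.

Lemma blank_eq_behead s1 s2 : blank_eq s1 s2 -> blank_eq (behead s1) (behead s2).
Proof. by move=> e i; rewrite !nth_behead e. Qed.

Lemma blank_eq_head s1 s2 : blank_eq s1 s2 -> head None s1 = head None s2.
Proof. by move=> e; rewrite -!nth0 e. Qed.

Lemma blank_eq_head_behead s : blank_eq (head None s :: behead s) s.
Proof. by case: s => // -[|[]]. Qed.

Lemma teq_refl t : teq t t.
Proof. by []. Qed.

Lemma teq_trans t u v : teq t u -> teq u v -> teq t v.
Proof.
by move=> [e1 e2] [f1 f2]; split=> i; [rewrite e1 f1 | rewrite e2 f2].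
Qed.

Lemma act1_teq x t u : teq t u -> teq (act1 x t) (act1 x u).
Proof.
case: x => y []; move=> [e1 e2]; rewrite /act1 /=; split=> //=.
- exact: blank_eq_behead.
- by rewrite (blank_eq_head e1); do 2!apply: blank_eq_cons; apply: blank_eq_behead.
- by apply: blank_eq_cons; apply: blank_eq_behead.
- exact: blank_eq_cons.
- exact: blank_eq_behead.
Qed.

Lemma act1_idle t : teq (act1 (head None t.2, Stay) t) t.
Proof. by split=> //=; apply: blank_eq_head_behead. Qed.

Lemma ceq_trans c d e : ceq c d -> ceq d e -> ceq c e.
Proof. by move=> h k j; apply: teq_trans (h j) (k j). Qed.

Lemma read_all_ceq c d : ceq c d -> read_all c = read_all d.
Proof. by move=> e; apply/ffunP=> j; rewrite !ffunE; apply: blank_eq_head; case: (e j). Qed.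

(* A machine exits when its next state is [None]. *)
Record machine : Type := Machine {
  mstate : finType;
  mstart : mstate;
  mnext : mstate -> reading -> option mstate * (reg -> cell * move)
}.

Inductive mrun (M : machine) : mstate M -> conf -> conf -> nat -> Prop :=
| mrun_exit q c f :
    mnext q (read_all c) = (None, f) -> mrun q c (act f c) 1
| mrun_step q q' c f d n :
    mnext q (read_all c) = (Some q', f) -> mrun q' (act f c) d n ->
    mrun q c d n.+1.

Definition idle (rd : reading) (j : reg) : cell * move := (rd j, Stay).

Lemma ceq_idle c : ceq (act (idle (read_all c)) c) c.
Proof. by move=> j; rewrite /act /idle ffunE; apply: act1_idle. Qed.

Definition Act (f : reading -> reg -> cell * move) : machine :=
  @Machine unit tt (fun _ rd => (None, f rd)).

(** The exiting step of [M] already enters [N], so times add up without overhead; [If] and [While]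
    spend one idle step on each test. *)
Definition Seq (M N : machine) : machine :=
  @Machine (mstate M + mstate N)%type (inl (mstart M)) (fun q rd =>
    match q with
    | inl q => let: (o, f) := mnext q rd in
        (Some (if o is Some q' then inl q' else inr (mstart N)), f)
    | inr q => let: (o, f) := mnext q rd in (omap inr o, f)
    end).

Definition If (p : pred reading) (M N : machine) : machine :=
  @Machine (option (mstate M + mstate N)) None (fun q rd =>
    match q with
    | None =>
        (Some (Some (if p rd then inl (mstart M) else inr (mstart N))), idle rd)
    | Some (inl q) => let: (o, f) := mnext q rd in (omap (Some \o inl) o, f)
    | Some (inr q) => let: (o, f) := mnext q rd in (omap (Some \o inr) o, f)
    end).

Definition While (p : pred reading) (M : machine) : machine :=
  @Machine (option (mstate M)) None (fun q rd =>
    match q with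
    | None => (if p rd then Some (Some (mstart M)) else None, idle rd)
    | Some q => let: (o, f) := mnext q rd in (Some o, f)
    end).

Notation "M ;; N" := (Seq M N) (at level 61, right associativity).

Lemma mrun_seq M N q c d e m n :
  @mrun M q c d m -> mrun (mstart N) d e n ->
  mrun (inl q : mstate (M ;; N)) c e (m + n).
Proof.
move=> rM rN; elim: rM rN => {q c d m} [q c f E|q q' c f d m E _ IH] rN.
  apply: (@mrun_step (M ;; N) _ (inr (mstart N)) _ f); first by rewrite /= E.
  elim: rN => {e n} [p c' g E'|p p' c' g d n E' _ IH'].
    by apply: mrun_exit; rewrite /= E'.
  by apply: mrun_step IH'; rewrite /= E'.
by apply: mrun_step (IH rN); rewrite /= E.
Qed.

Lemma mrun_if_l p M N q c d m :
  @mrun M q c d m -> mrun (Some (inl q) : mstate (If p M N)) c d m.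
Proof.
elim=> {c d m} [{}q c f E|{}q q' c f d m E _ IH].
  by apply: mrun_exit; rewrite /= E.
by apply: mrun_step IH; rewrite /= E.
Qed.

Lemma mrun_if_r p M N q c d m :
  @mrun N q c d m -> mrun (Some (inr q) : mstate (If p M N)) c d m.
Proof.
elim=> {c d m} [{}q c f E|{}q q' c f d m E _ IH].
  by apply: mrun_exit; rewrite /= E.
by apply: mrun_step IH; rewrite /= E.
Qed.

Lemma mrun_while p M q c d e m n :
  @mrun M q c d m -> mrun (None : mstate (While p M)) d e n ->
  mrun (Some q : mstate (While p M)) c e (m + n).
Proof.
move=> rM rW; elim: rM rW => {q c d m} [q c f E|q q' c f d m E _ IH] rW.
  by apply: mrun_step rW; rewrite /= E.
by apply: mrun_step (IH rW); rewrite /= E.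
Qed.

(** Quantifying over all configurations equal to [a] up to padding makes runs compose, since a
    machine leaves explicit blanks that the description [b] need not show. The time is an upper
    bound only. *)
Variant trun (M : machine) (a b : conf) (n : nat) : Prop :=
  Trun of forall c, ceq c a ->
    exists2 d, ceq d b & exists2 m, m <= n & mrun (mstart M) c d m.

Lemma trun_weak M a a' b b' n n' :
  trun M a b n -> ceq a' a -> ceq b b' -> n <= n' -> trun M a' b' n'.
Proof.
move=> [r] ea eb ln; split=> c ec; have [d ed [m lm rm]] := r c (ceq_trans ec ea).
by exists d; [apply: ceq_trans ed eb | exists m => //; apply: leq_trans ln].
Qed.

Lemma trun_act f a b : ceq (act (f (read_all a)) a) b -> trun (Act f) a b 1.
Proof.
move=> eb; split=> c ec; exists (act (f (read_all c)) c); last first.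
  by exists 1 => //; apply: mrun_exit.
apply: ceq_trans eb => j; rewrite (read_all_ceq ec).
exact: act1_teq.
Qed.

Lemma trun_seq M N a b d m n :
  trun M a b m -> trun N b d n -> trun (M ;; N) a d (m + n).
Proof.
move=> [rM] [rN]; split=> c ec; have [c1 e1 [i li r1]] := rM _ ec.
have [c2 e2 [j lj r2]] := rN _ e1.
by exists c2 => //; exists (i + j); [apply: leq_add | apply: mrun_seq r2].
Qed.

Lemma trun_if (p : pred reading) M N a b n :
  trun (if p (read_all a) then M else N) a b n -> trun (If p M N) a b n.+1.
Proof.
move=> [r]; split=> c ec; have ec' := ceq_trans (ceq_idle c) ec.
have [d ed [m lm rm]] := r _ ec'.
exists d => //; exists m.+1 => //.
apply: (@mrun_step (If p M N) None); first exact: erefl.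
rewrite (read_all_ceq ec); rewrite (read_all_ceq ec) in rm.
by case: (p _) rm => rm; [exact: mrun_if_l | exact: mrun_if_r].
Qed.

Lemma trun_while0 (p : pred reading) M a : ~~ p (read_all a) -> trun (While p M) a a 1.
Proof.
move=> pa; split=> c ec; exists (act (idle (read_all c)) c).
  exact: ceq_trans (ceq_idle c) ec.
exists 1 => //; apply: (@mrun_exit (While p M)).
by rewrite /= (read_all_ceq ec) (negPf pa).
Qed.

Lemma trun_while1 (p : pred reading) M a b d m n :
  p (read_all a) -> trun M a b m -> trun (While p M) b d n ->
  trun (While p M) a d (m + n).+1.
Proof.
move=> pa [rM] [rW]; split=> c ec; have ec' := ceq_trans (ceq_idle c) ec.
have [c1 e1 [i li r1]] := rM _ ec'.
have [c2 e2 [j lj r2]] := rW _ e1.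
exists c2 => //; exists (i + j).+1; first by rewrite ltnS leq_add.
apply: (@mrun_step (While p M) None (Some (mstart M)) _ (idle (read_all c))).
  by rewrite /= (read_all_ceq ec) pa.
exact: mrun_while r2.
Qed.

Definition turing_of (M : machine) : turing_machine token :=
  @TuringMachine token (option (mstate M)) void 12 (Some (mstart M))
    (fun q => q == None)
    (fun q rd => if q is Some q' then mnext q' rd else (None, idle rd)).

Definition cells (s : seq token) : seq cell := [seq Some (inl x) | x <- s].

Lemma word_prefix_cells M r (v : seq token) :
  blank_eq r (cells v) -> @word_prefix _ (turing_of M) r = v.
Proof.
elim: v r => [|x v IH] [|y r] e //; have := e 0 => //= -> //.
by congr (_ :: _); apply: IH => i; apply: (e i.+1).
Qed.

Definition initial (w : seq token) : conf :=
  fun j => if j == ord0 then ([::], cells w) else ([::], [::]).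

Lemma turing_of_computes M w v n d :
  trun M (initial w) d n -> blank_eq (d ord0).2 (cells v) ->
  tm_computes_within (turing_of M) w v n.
Proof.
move=> [/(_ (initial w) (fun j => teq_refl _))] [d' ed [m lm rm]] ev.
exists m => //.
have {ed}ev : blank_eq (d' ord0).2 (cells v).
  by move=> i; case: (ed ord0) => _ ->; apply: ev.
suff E : iter m (@tm_step _ (turing_of M)) (tm_init (turing_of M) w) = (None, d').
  by rewrite E; split=> //; apply: word_prefix_cells.
rewrite -[tm_init _ _]/(Some (mstart M), initial w).
elim: rm {ev lm} => {d' m} [q c f E|q q' c f d' m E _ IH].
  by rewrite /= /tm_step /= [mnext _ _]E.
by rewrite iterSr {2}/tm_step /= [mnext _ _]E.
Qed.

(** * Words on tapes *)

Definition upd (a : conf) (r : reg) (t : ztape) : conf :=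
  fun j => if j == r then t else a j.

Definition Act1 (r : reg) (g : reading -> cell * move) : machine :=
  Act (fun rd j => if j == r then g rd else idle rd j).

Definition MvR r := Act1 r (fun rd => (rd r, MoveRight)).
Definition MvL r := Act1 r (fun rd => (rd r, MoveLeft)).
Definition Write r x := Act1 r (fun=> (x, Stay)).
Definition CopyCell r s := Act1 s (fun rd => (rd r, Stay)).
Definition Nop := Act idle.

Lemma trun_act1 r g a :
  trun (Act1 r g) a (upd a r (act1 (g (read_all a)) (a r))) 1.
Proof.
apply: trun_act => j; rewrite /act /upd; case: eqP => [->|_] //.
by rewrite /idle ffunE; apply: act1_idle.
Qed.

Lemma trun_nop a : trun Nop a a 1.
Proof. exact/trun_act/ceq_idle. Qed.

Definition tape_r (t : ztape) : ztape := (head None t.2 :: t.1, behead t.2).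
Definition tape_l (t : ztape) : ztape := (behead t.1, head None t.1 :: t.2).

Lemma ceq_upd a b r t u : ceq a b -> teq t u -> ceq (upd a r t) (upd b r u).
Proof. by move=> ab tu j; rewrite /upd; case: eqP. Qed.

Lemma ceq_refl a : ceq a a. Proof. by []. Qed.
Hint Resolve teq_refl ceq_refl : core.

Lemma trun_mvr r a : trun (MvR r) a (upd a r (tape_r (a r))) 1.
Proof.
apply: (trun_weak (trun_act1 r (fun rd => (rd r, MoveRight)) a)) => //; apply: ceq_upd => //.
by rewrite ffunE.
Qed.

Lemma trun_mvl r a : trun (MvL r) a (upd a r (tape_l (a r))) 1.
Proof.
apply: (trun_weak (trun_act1 r (fun rd => (rd r, MoveLeft)) a)) => //; apply: ceq_upd => //.
rewrite ffunE; split=> //=; apply: blank_eq_cons.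
exact: blank_eq_head_behead.
Qed.

Lemma trun_write r x a :
  trun (Write r x) a (upd a r ((a r).1, x :: behead (a r).2)) 1.
Proof. exact: trun_act1. Qed.

Lemma trun_copycell r s a :
  trun (CopyCell r s) a
    (upd a s ((a s).1, head None (a r).2 :: behead (a s).2)) 1.
Proof.
apply: (trun_weak (trun_act1 s (fun rd => (rd r, Stay)) a)) => //; apply: ceq_upd => //.
by rewrite ffunE.
Qed.

Definition delim (x : token) : bool :=
  match x with TOpen | TClose | TComma | TArrow => true | _ => false end.
Definition is_word (u : seq token) : bool := all (predC delim) u.
Definition word_cell (x : cell) : bool :=
  if x is Some (inl y) then ~~ delim y else false.

Notation on_word r := (fun rd : reading => word_cell (rd r)).
Definition SkipR r := While (on_word r) (MvR r).
Definition Rewind r := MvL r ;; While (on_word r) (MvL r).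

Ltac by_reg :=
  let j := fresh "j" in move=> j; rewrite /upd;
  repeat match goal with
  | |- context [@eq_op _ ?x ?x] => rewrite eqxx
  | H : @eq_op _ ?x ?y = false |- context [@eq_op _ ?x ?y] => rewrite H
  | |- context [@eq_op ?T j ?r] => case: (@eqP T j r) => [?|_]; try subst j
  | H : ?a ?r = (_, _) |- context [?a ?r] => rewrite H
  | H : ?a ?r = tape_l _ |- context [?a ?r] => rewrite H
  end; rewrite /= ?catA //.

Lemma trun_skipR r l u R a :
  is_word u -> ~~ word_cell (head None R) -> a r = (l, cells u ++ R) ->
  trun (SkipR r) a (upd a r (rev (cells u) ++ l, R)) (2 * size u + 1).
Proof.
elim: u l a => [|x u IH] l a /=.
  move=> _ hR ar; apply: (@trun_weak _ a a a _ 1) => //.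
    by apply: trun_while0; rewrite ffunE ar.
  by_reg.
move=> /andP[hx hu] hR ar.
apply: trun_weak (trun_while1 _ (trun_mvr r a) (IH (Some (inl x) :: l) _ hu hR _)) _ _ _ => //.
- by rewrite ffunE ar.
- by rewrite /upd eqxx ar.
- by rewrite rev_cons cat_rcons; by_reg.
- lia.
Qed.

(** The word [v] is reversed, as it lies to the left of the head. Writing the tape with [tape_l]
    covers both cases of the cell just reached, a letter of the word or the delimiter [x] that stops
    the loop. *)
Lemma trun_rewind_while r l x v R a :
  is_word v -> delim x ->
  a r = tape_l (cells v ++ Some (inl x) :: l, R) ->
  trun (While (on_word r) (MvL r)) a
    (upd a r (l, Some (inl x) :: rev (cells v) ++ R)) (2 * size v + 1).
Proof.
elim: v R a => [|y v IH] R a /=.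
  move=> _ hx ar; apply: (@trun_weak _ a a a _ 1) => //.
    by apply: trun_while0; rewrite ffunE ar /= hx.
  by_reg.
move=> /andP[hy hv] hx ar.
apply: trun_weak (trun_while1 _ (trun_mvl r a) (IH (Some (inl y) :: R) _ hv hx _)) _ _ _ => //.
- by rewrite ffunE ar.
- by rewrite /upd eqxx ar.
- by rewrite rev_cons cat_rcons; by_reg.
- lia.
Qed.

Lemma cells_rev u : cells (rev u) = rev (cells u).
Proof. exact: map_rev. Qed.

Lemma is_word_rev u : is_word (rev u) = is_word u.
Proof. exact: all_rev. Qed.

Lemma trun_rewind r l x u R a :
  is_word u -> delim x -> a r = (rev (cells u) ++ Some (inl x) :: l, R) ->
  trun (Rewind r) a (upd a r (l, Some (inl x) :: cells u ++ R)) (2 * size u + 2).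
Proof.
rewrite -is_word_rev -cells_rev => hu hx ar.
apply: trun_weak (trun_seq (trun_mvl r a) (trun_rewind_while hu hx _)) _ _ _ => //.
- by rewrite /upd eqxx ar.
- by rewrite cells_rev revK; by_reg.
- by rewrite size_rev; lia.
Qed.

(* The tape [s] is written from right to left while [r] is rewound. *)
Definition Back r s := MvL r ;; MvL s ;; CopyCell r s.
Definition CopyItem r s :=
  MvR r ;; SkipR r ;; Back r s ;; While (on_word r) (Back r s).

Lemma trun_back r s a : r != s ->
  trun (Back r s) a
    (upd (upd a s (behead (a s).1, head None (a r).1 :: (a s).2)) r
       (tape_l (a r))) 3.
Proof.
move=> rs; have rsF := negPf rs; have srF : (s == r) = false by rewrite eq_sym.
apply: trun_weak (trun_seq (trun_mvl _ _)
  (trun_seq (trun_mvl _ _) (trun_copycell _ _ _))) _ _ _ => //.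
by_reg.
Qed.

(** The invariant holds just after a cell has been copied: the head of [s] shows the same cell as
    that of [r]. The loop therefore stops only once the delimiter has been copied as well. *)
Lemma trun_back_while r s l x v R ls ys a : r != s ->
  is_word v -> delim x ->
  a r = tape_l (cells v ++ Some (inl x) :: l, R) ->
  a s = (ls, head None (cells v ++ [:: Some (inl x)]) :: ys) ->
  exists ls', trun (While (on_word r) (Back r s)) a
    (upd (upd a s (ls', Some (inl x) :: rev (cells v) ++ ys)) r
       (l, Some (inl x) :: rev (cells v) ++ R)) (4 * size v + 1).
Proof.
move=> rs; have rsF := negPf rs; have srF : (s == r) = false by rewrite eq_sym.
elim: v R ls ys a => [|y v IH] R ls ys a /=.
  move=> _ hx ar as_; exists ls; apply: (@trun_weak _ a a a _ 1) => //.
    by apply: trun_while0; rewrite ffunE ar /= hx.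
  by_reg.
move=> /andP[hy hv] hx ar as_.
pose a' := upd (upd a s (behead (a s).1, head None (a r).1 :: (a s).2)) r
       (tape_l (a r)).
have [||ls' H] := IH (Some (inl y) :: R) (behead ls) (Some (inl y) :: ys) a' hv hx.
- by rewrite /a' /upd eqxx ar.
- by rewrite /a' /upd eqxx srF as_ ar; case: (v).
exists ls'; apply: trun_weak (trun_while1 _ (trun_back a rs) H) _ _ _ => //.
- by rewrite ffunE ar.
- by rewrite rev_cons !cat_rcons /a'; by_reg.
- lia.
Qed.

Lemma trun_copy r s l x u R ls ys a : r != s ->
  is_word u -> delim x -> ~~ word_cell (head None R) ->
  a r = (l, Some (inl x) :: cells u ++ R) -> a s = (ls, ys) ->
  exists ls', trun (CopyItem r s) a
    (upd a s (ls', Some (inl x) :: cells u ++ ys)) (6 * size u + 6).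
Proof.
move=> rs hu hx hR ar as_.
have rsF := negPf rs; have srF : (s == r) = false by rewrite eq_sym.
set a1 := upd a r (tape_r (a r)).
have r1 : trun (MvR r) a a1 1 := trun_mvr r a.
set a2 := upd a1 r (rev (cells u) ++ Some (inl x) :: l, R).
have r2 : trun (SkipR r) a1 a2 (2 * size u + 1).
  by apply: trun_skipR => //; rewrite /a1 /upd eqxx ar.
have r3 := trun_back a2 rs; move: r3; set a3 := (X in trun _ _ X _) => r3.
have [| | | |ls' r4] := @trun_back_while r s l x (rev u) R (behead ls) ys a3 rs.
- by rewrite is_word_rev.
- by [].
- by rewrite /a3 /a2 /upd !eqxx cells_rev.
- rewrite /a3 /a2 /a1 /upd !eqxx srF as_ cells_rev /=.
  by case: (rev _).
exists ls'.
apply: trun_weak (trun_seq r1 (trun_seq r2 (trun_seq r3 r4))) _ _ _ => //.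
- by rewrite /a3 /a2 /a1 !cells_rev !revK; by_reg.
- by rewrite size_rev; lia.
Qed.

Definition DropItem r := MvR r ;; SkipR r.

Lemma trun_drop r l x u R a :
  is_word u -> ~~ word_cell (head None R) ->
  a r = (l, Some (inl x) :: cells u ++ R) ->
  exists l', trun (DropItem r) a (upd a r (l', R)) (2 * size u + 2).
Proof.
move=> hu hR ar.
eexists; apply: trun_weak (trun_seq (trun_mvr _ _) (trun_skipR hu hR _)) _ _ _ => //.
- by rewrite /upd eqxx ar.
- by_reg.
- lia.
Qed.

Definition Push r (x : token) := MvL r ;; Write r (Some (inl x)).

Lemma trun_push r x a :
  trun (Push r x) a (upd a r (behead (a r).1, Some (inl x) :: (a r).2)) 2.
Proof.
apply: trun_weak (trun_seq (trun_mvl _ _) (trun_write _ _ _)) _ _ _ => //.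
by rewrite /upd eqxx /=; by_reg.
Qed.

(** * Comparison of two words *)

Definition same_word (r s : reg) (rd : reading) : bool :=
  word_cell (rd r) && (rd r == rd s).
Definition Scan r s := (MvR r ;; MvR s) ;; While (same_word r s) (MvR r ;; MvR s).
Definition both_end (r s : reg) (rd : reading) : bool :=
  ~~ word_cell (rd r) && ~~ word_cell (rd s).
(** The scan starts behind the delimiters, so a succedent can be compared with a hypothesis although
    their tags differ. Both heads return before the branch is taken; a comparison leaves no
    trace. *)
Definition IfEq r s M N :=
  Scan r s ;; If (both_end r s) (Rewind r ;; Rewind s ;; M)
                                (Rewind r ;; Rewind s ;; N).

Lemma trun_mvr2 r s a : r != s ->
  trun (MvR r ;; MvR s) a (upd (upd a s (tape_r (a s))) r (tape_r (a r))) 2.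
Proof.
move=> rs; have rsF := negPf rs; have srF : (s == r) = false by rewrite eq_sym.
apply: trun_weak (trun_seq (trun_mvr _ _) (trun_mvr _ _)) _ _ _ => //.
by_reg.
Qed.

(** Here [p] is the longest common prefix. Words contain no delimiter, so both heads leave their
    words together exactly when the words agree; a proper prefix is detected because the other head
    still sees a letter. *)
Lemma trun_scan_while r s l1 l2 u1 u2 R1 R2 a : r != s ->
  is_word u1 -> is_word u2 ->
  ~~ word_cell (head None R1) -> ~~ word_cell (head None R2) ->
  a r = (l1, cells u1 ++ R1) -> a s = (l2, cells u2 ++ R2) ->
  exists p v1 v2,
    [/\ u1 = p ++ v1, u2 = p ++ v2,
      (u1 == u2) = ~~ word_cell (head None (cells v1 ++ R1))
                && ~~ word_cell (head None (cells v2 ++ R2)) &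
    trun (While (same_word r s) (MvR r ;; MvR s)) a
      (upd (upd a s (rev (cells p) ++ l2, cells v2 ++ R2)) r
        (rev (cells p) ++ l1, cells v1 ++ R1)) (3 * size p + 1)].
Proof.
move=> rs; have rsF := negPf rs; have srF : (s == r) = false by rewrite eq_sym.
move=> + + h1 h2; elim: u1 u2 l1 l2 a => [|x1 u1 IH] u2 l1 l2 a.
  move=> _ w2 ar as_; exists [::], [::], u2; split=> //=.
    by rewrite h1; case: u2 w2 {as_} => [|x u2] /=; rewrite ?h2 // => /andP[->].
  apply: (@trun_weak _ a a a _ 1) => //.
    by apply: trun_while0; rewrite /same_word ffunE ar negb_and h1.
  by_reg.
case: u2 => [|x2 u2] /= /andP[wx1 w1].
  move=> _ ar as_; exists [::], (x1 :: u1), [::]; split=> //=.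
    by rewrite wx1.
  apply: (@trun_weak _ a a a _ 1) => //.
    apply: trun_while0; rewrite /same_word !ffunE ar as_ /= wx1 /=.
    by apply: contra h2 => /eqP <-.
  by_reg.
move=> /andP[wx2 w2] ar as_; have [ex|nx] := eqVneq x1 x2; last first.
  exists [::], (x1 :: u1), (x2 :: u2); split=> //=.
    by rewrite wx1 eqseq_cons (negPf nx).
  apply: (@trun_weak _ a a a _ 1) => //.
    apply: trun_while0; rewrite /same_word !ffunE ar as_ /= wx1 /=.
    by apply: contra nx => /eqP[->].
  by_reg.
subst x2; pose a' := upd (upd a s (tape_r (a s))) r (tape_r (a r)).
have [||p [v1 [v2 [e1 e2 e3 H]]]] :=
  IH u2 (Some (inl x1) :: l1) (Some (inl x1) :: l2) a' w1 w2.
- by rewrite /a' /upd eqxx ar.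
- by rewrite /a' /upd eqxx srF as_.
exists (x1 :: p), v1, v2; split; rewrite /= -?e1 -?e2 //.
  by rewrite eqseq_cons eqxx.
apply: trun_weak (trun_while1 _ (trun_mvr2 a rs) H) _ _ _ => //.
- by rewrite /same_word !ffunE ar as_ /= wx1 eqxx.
- by rewrite rev_cons !cat_rcons /a'; by_reg.
- by clear; lia.
Qed.

Lemma trun_ifeq r s l1 l2 x1 x2 u1 u2 R1 R2 M N a b n : r != s ->
  is_word u1 -> is_word u2 -> delim x1 -> delim x2 ->
  ~~ word_cell (head None R1) -> ~~ word_cell (head None R2) ->
  a r = (l1, Some (inl x1) :: cells u1 ++ R1) ->
  a s = (l2, Some (inl x2) :: cells u2 ++ R2) ->
  trun (if u1 == u2 then M else N) a b n ->
  trun (IfEq r s M N) a b (7 * size u1 + 8 + n).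
Proof.
move=> rs w1 w2 d1 d2 h1 h2 ar as_ rn.
have rsF := negPf rs; have srF : (s == r) = false by rewrite eq_sym.
pose a1 := upd (upd a s (tape_r (a s))) r (tape_r (a r)).
have [||p [v1 [v2 [e1 e2 e3 rW]]]] :=
  @trun_scan_while r s (Some (inl x1) :: l1) (Some (inl x2) :: l2)
     u1 u2 R1 R2 a1 rs w1 w2 h1 h2.
- by rewrite /a1 /upd eqxx ar.
- by rewrite /a1 /upd eqxx srF as_.
move: rW; set a2 := (X in trun _ _ X _) => rW.
have wp : is_word p by move: w1; rewrite e1 /is_word all_cat => /andP[].
have rS : trun (Scan r s) a a2 (3 * size p + 3).
  by apply: trun_weak (trun_seq (trun_mvr2 a rs) rW) _ _ _ => //; clear; lia.
pose a3 := upd a2 r (l1, Some (inl x1) :: cells p ++ (cells v1 ++ R1)).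
have r3 : trun (Rewind r) a2 a3 (2 * size p + 2).
  by apply: trun_rewind => //; rewrite /a2 /upd eqxx.
pose a4 := upd a3 s (l2, Some (inl x2) :: cells p ++ (cells v2 ++ R2)).
have r4 : trun (Rewind s) a3 a4 (2 * size p + 2).
  by apply: trun_rewind => //; rewrite /a3 /a2 /upd srF eqxx.
have e4 : ceq a4 a.
  move=> j; rewrite /a4 /a3 /a2 /a1 /upd; case: eqP => [->|_].
    by rewrite as_ e2 catA /cells map_cat.
  by case: eqP => [->|_] //; rewrite ar e1 catA /cells map_cat.
have rn' := trun_weak rn e4 (ceq_refl b) (leqnn n).
have lp : size p <= size u1 by rewrite e1 size_cat leq_addr.
have ht : both_end r s (read_all a2) = (u1 == u2).
  by rewrite e3 /both_end !ffunE /a2 /upd !eqxx srF.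
have r5 : trun (If (both_end r s) (Rewind r ;; Rewind s ;; M)
    (Rewind r ;; Rewind s ;; N)) a2 b (4 * size p + 4 + n).+1.
  apply: trun_if; rewrite ht.
  by case: eqP rn' => _ rn';
    apply: trun_weak (trun_seq r3 (trun_seq r4 rn')) _ _ _ => //; clear; lia.
by apply: trun_weak (trun_seq rS r5) _ _ _ => //; move: lp; clear; lia.
Qed.

(** * Splitting a disjunction *)

Definition mark : cell := Some (inl TBot).

Definition binary_cell (x : cell) : bool :=
  if x is Some (inl (TOr | TAnd | TImp)) then true else false.
Definition leaf_cell (x : cell) : bool :=
  if x is Some (inl (TBot | TEnd)) then true else false.

(** A unary counter with its head on the leftmost mark: a mark is added on the left, or the head
    steps over one, and the test for zero reads one cell. Marks stepped over remain as garbage on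
    the left, which the next increment overwrites. *)
Definition Count r c :=
  If (fun rd => binary_cell (rd r)) (MvL c ;; Write c mark)
    (If (fun rd => leaf_cell (rd r)) (MvR c) Nop).

(* In prefix notation, the number of formulas still to be read before the end
   of the current one, given that it is [k.+1] before the token [x]. *)
Definition pending (x : token) (k : nat) : nat :=
  if binary_cell (Some (inl x)) then k.+2
  else if leaf_cell (Some (inl x)) then k else k.+1.

Lemma trun_count r c x lc k a :
  head None (a r).2 = Some (inl x) -> a c = (lc, nseq k.+1 mark) ->
  exists lc', trun (Count r c) a (upd a c (lc', nseq (pending x k) mark)) 4.
Proof.
move=> hx ac; rewrite /pending.
have hx' : read_all a r = Some (inl x) by rewrite ffunE.
case hb: (binary_cell _); last case hl: (leaf_cell _).
- have := trun_seq (trun_mvl c a) (trun_write c mark _).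
  move=> r1; exists (behead lc); apply: (@trun_weak _ a a _ _ 3).
  + by apply: trun_if; rewrite hx' hb; apply: r1.
  + by [].
  + by rewrite /=; by_reg.
  + by [].
- have r1 := trun_mvr c a; exists (mark :: lc); apply: (@trun_weak _ a a _ _ 3).
  + by apply: trun_if; rewrite hx' hb; apply: trun_if; rewrite hx' hl; apply: r1.
  + by [].
  + by by_reg.
  + by [].
- exists lc; apply: (@trun_weak _ a a a _ 3) => //; last by by_reg.
  by apply: trun_if; rewrite hx' hb; apply: trun_if; rewrite hx' hl; apply: trun_nop.
Qed.

Definition SplitStep r s c := CopyCell r s ;; MvR s ;; Count r c ;; MvR r.
Definition SplitLoop r s c := While (fun rd => rd c == mark) (SplitStep r s c).

Definition upd3 a r tr s ts c tc := upd (upd (upd a c tc) s ts) r tr.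

Section Split.
Variables (r s c : reg) (a : conf).
Hypotheses (rs : (r == s) = false) (rc : (r == c) = false) (sc : (s == c) = false).
Let sr : (s == r) = false. Proof. by rewrite eq_sym. Qed.
Let cr : (c == r) = false. Proof. by rewrite eq_sym. Qed.
Let cs : (c == s) = false. Proof. by rewrite eq_sym. Qed.

Lemma trun_split_step lr ls lc x R k : exists lc',
  trun (SplitStep r s c)
    (upd3 a r (lr, Some (inl x) :: R) s (ls, [::]) c (lc, nseq k.+1 mark))
    (upd3 a r (Some (inl x) :: lr, R) s (Some (inl x) :: ls, [::])
        c (lc', nseq (pending x k) mark)) 7.
Proof.
pose a0 := upd3 a r (lr, Some (inl x) :: R) s (ls, [::]) c (lc, nseq k.+1 mark).
pose a1 := upd a0 s ((a0 s).1, head None (a0 r).2 :: behead (a0 s).2).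
have r1 : trun (CopyCell r s) a0 a1 1 := trun_copycell r s a0.
pose a2 := upd a1 s (tape_r (a1 s)).
have r2 : trun (MvR s) a1 a2 1 := trun_mvr s a1.
have [||lc' r3] := @trun_count r c x lc k a2.
- by rewrite /a2 /a1 /a0 /upd3 /upd rs eqxx.
- by rewrite /a2 /a1 /a0 /upd3 /upd cr cs eqxx.
exists lc'; apply: trun_weak (trun_seq r1 (trun_seq r2 (trun_seq r3 (trun_mvr _ _)))) _ _ _ => //.
by rewrite /a2 /a1 /a0 /upd3; by_reg.
Qed.

(** A continuation form: the loop does not stop between subformulas, so what is proved about one of
    them must speak of the rest of the loop. The left half of the counter tape is left arbitrary. *)
Definition split_reaches (Q : conf -> Prop) (a' : conf) (n : nat) : Prop :=
  exists2 b, Q b & trun (SplitLoop r s c) a' b n.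

Lemma trun_split_loop1 lr ls lc x R k Q n :
  (forall lc', split_reaches Q
     (upd3 a r (Some (inl x) :: lr, R) s (Some (inl x) :: ls, [::])
        c (lc', nseq (pending x k) mark)) n) ->
  split_reaches Q
    (upd3 a r (lr, Some (inl x) :: R) s (ls, [::]) c (lc, nseq k.+1 mark)) (n + 8).
Proof.
move=> H; have [lc' r1] := trun_split_step lr ls lc x R k.
have [b qb rb] := H lc'; exists b => //.
apply: trun_weak (trun_while1 _ r1 rb) _ _ _ => //; last by lia.
by rewrite /= ffunE /upd3 /upd cr cs eqxx.
Qed.

(** Reading one complete formula lowers the counter by exactly one. A binary connective first raises
    it by one, and its two arguments then lower it by one each. *)
Lemma trun_split_loop f lr ls lc R k Q n :
  (forall lc', split_reaches Q
     (upd3 a r (rev (cells (encode_formula f)) ++ lr, R)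
        s (rev (cells (encode_formula f)) ++ ls, [::]) c (lc', nseq k mark)) n) ->
  split_reaches Q
    (upd3 a r (lr, cells (encode_formula f) ++ R) s (ls, [::])
       c (lc, nseq k.+1 mark)) (n + 8 * size (encode_formula f)).
Proof.
elim: f lr ls lc R k n => [bs||f IHf g IHg|f IHf g IHg|f IHf g IHg] lr ls lc R k n H /=.
(* An atom uses up its unit of the counter only at [TEnd]; over the bits of its name the counter is
   constant, which calls for an inner induction. *)
- suff E : forall lr ls lc n, (forall lc', split_reaches Q
     (upd3 a r (rev (cells (map TBit bs ++ [:: TEnd])) ++ lr, R)
        s (rev (cells (map TBit bs ++ [:: TEnd])) ++ ls, [::]) c (lc', nseq k mark)) n) ->
     split_reaches Q
      (upd3 a r (lr, cells (map TBit bs ++ [:: TEnd]) ++ R) s (ls, [::])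
       c (lc, nseq k.+1 mark)) (n + 8 * size (map TBit bs ++ [:: TEnd])).
    rewrite mulnS addnCA addnC; apply: trun_split_loop1 => lc'.
    by apply: E => lc2; have := H lc2; rewrite /= !rev_cons !cat_rcons.
  elim: (bs) => [|y t IH] {lr ls lc n H} lr ls lc n H /=; rewrite mulnS addnCA addnC;
    apply: trun_split_loop1 => lc'.
    by rewrite addn0; apply: H.
  by apply: IH => lc2; have := H lc2; rewrite /= !rev_cons !cat_rcons.
- by rewrite muln1; apply: trun_split_loop1 => lc'; apply: H.
all: rewrite mulnS addnCA addnC; apply: trun_split_loop1 => lc'.
all: rewrite size_cat mulnDr addnCA addnC.
all: rewrite /cells map_cat -catA; apply: IHf => lc2; apply: IHg => lc3.
all: have := H lc3; rewrite /= !rev_cons /cells map_cat rev_cat !cat_rcons -!catA.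
all: by [].
Qed.

(** The two moves skip the delimiter and [TOr]. When the loop stops, the head of [r] is at the
    second disjunct, and [Push] puts the new delimiter over the last cell of the first one, which
    has been copied to [s]. *)
Definition SplitOr :=
  (MvR r ;; MvR r ;; Write s (Some (inl TComma)) ;; MvR s ;; MvL c ;; Write c mark) ;;
  SplitLoop r s c ;; Rewind s ;; Push r TComma.

End Split.

(** * Registers *)

(* Registers hold lists of items: a delimiter followed by a word free of
   delimiters. *)
Definition item : Type := (token * seq token)%type.
Definition env : Type := seq (seq item).

Definition flat (xs : seq item) : seq token := flatten [seq i.1 :: i.2 | i <- xs].
Definition good (N : nat) (i : item) : bool :=
  [&& delim i.1, is_word i.2 & size i.2 <= N].

Definition get (e : env) (r : reg) : seq item := nth [::] e r.
Definition put (e : env) (r : reg) (xs : seq item) : env := set_nth [::] e r xs.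

Lemma get_put e r xs j : get (put e r xs) j = if j == r then xs else get e j.
Proof. by rewrite /get /put nth_set_nth. Qed.

(** Only the half from the head rightwards represents the register. The left half holds whatever was
    popped, and pushing overwrites it. *)
Definition rep (N : nat) (c : conf) (e : env) : Prop :=
  forall j, blank_eq (c j).2 (cells (flat (get e j))) /\ all (good N) (get e j).

Lemma rep_upd N c e r l xs :
  rep N c e -> all (good N) xs ->
  rep N (upd c r (l, cells (flat xs))) (put e r xs).
Proof. by move=> h hx j; rewrite /upd get_put; case: eqP. Qed.

(* Since no operation lengthens words, every step of a program on registers
   takes time linear in the maximal word length [N]; the contents of the
   registers may be much longer. *)
Definition cost (N : nat) : nat := 20 * N.+1.

Variant exec (M : machine) (e e' : env) (t : nat) : Prop :=
  Exec of forall N a, rep N a e ->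
    exists2 b, rep N b e' & trun M a b (t * cost N).

Definition canonical (ls : reg -> seq cell) (e : env) : conf :=
  fun j => (ls j, cells (flat (get e j))).

(** A primitive needs to be checked only on right halves that are literally the encodings of the
    registers; [trun] absorbs the padding. *)
Lemma exec_canonical M e e' :
  (forall N ls, rep N (canonical ls e) e ->
    exists2 b, rep N b e' & trun M (canonical ls e) b (cost N)) ->
  exec M e e' 1.
Proof.
move=> H; split=> N a ha.
have ra : rep N (canonical (fun j => (a j).1) e) e.
  by move=> j; split=> //; case: (ha j).
have [b hb rb] := H N _ ra; exists b => //.
by apply: trun_weak rb _ _ _ => //; [move=> j; case: (ha j) | rewrite mul1n].
Qed.

Lemma exec_weak M e e' e'' t t' :
  exec M e e' t -> (forall j, get e' j = get e'' j) -> t <= t' -> exec M e e'' t'.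
Proof.
move=> [H] he lt; split=> N a ha; have [b hb rb] := H N a ha.
exists b; first by move=> j; rewrite -he.
by apply: trun_weak rb _ _ _ => //; rewrite leq_mul2r lt orbT.
Qed.

Lemma exec_le M e e' t t' : exec M e e' t -> t <= t' -> exec M e e' t'.
Proof. by move=> H; apply: exec_weak H _. Qed.

Lemma exec_seq M M' e e' e'' t t' :
  exec M e e' t -> exec M' e' e'' t' -> exec (M ;; M') e e'' (t + t').
Proof.
move=> [H] [H']; split=> N a ha; have [b hb rb] := H N a ha.
have [d hd rd] := H' N b hb; exists d => //.
by rewrite mulnDl; apply: trun_seq rd.
Qed.

Lemma exec_nop e : exec Nop e e 1.
Proof.
apply: exec_canonical => N ls h; exists (canonical ls e) => //.
by apply: trun_weak (trun_nop _) _ _ _.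
Qed.

Definition top_token (x : cell) : option token :=
  if x is Some (inl y) then Some y else None.
Definition on_top (r : reg) (p : pred (option token)) : pred reading :=
  fun rd => p (top_token (rd r)).
Definition tag (xs : seq item) : option token := omap fst (ohead xs).

Lemma on_top_rep N a e r (p : pred (option token)) :
  rep N a e -> on_top r p (read_all a) = p (tag (get e r)).
Proof.
move=> h; case: (h r) => h1 _; rewrite /on_top ffunE (blank_eq_head h1).
by case: (get e r).
Qed.

Lemma exec_if r (p : pred (option token)) M M' e e' t :
  exec (if p (tag (get e r)) then M else M') e e' t ->
  exec (If (on_top r p) M M') e e' t.+1.
Proof.
move=> [H]; split=> N a ha; have [b hb rb] := H N a ha; exists b => //.
have r1 : trun (If (on_top r p) M M') a b (t * cost N).+1.
  by apply: trun_if; rewrite (on_top_rep _ _ ha).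
apply: trun_weak r1 _ _ _ => //.
by rewrite mulSn -addn1 addnC leq_add.
Qed.

Lemma exec_while0 r (p : pred (option token)) M e :
  ~~ p (tag (get e r)) -> exec (While (on_top r p) M) e e 1.
Proof.
move=> hp; split=> N a ha; exists a => //.
by apply: trun_weak (trun_while0 _ _) _ _ _ => //; rewrite (on_top_rep _ _ ha).
Qed.

Lemma exec_while1 r (p : pred (option token)) M e e' e'' t t' :
  p (tag (get e r)) -> exec M e e' t -> exec (While (on_top r p) M) e' e'' t' ->
  exec (While (on_top r p) M) e e'' (t + t').+1.
Proof.
move=> hp [H] [H']; split=> N a ha; have [b hb rb] := H N a ha.
have [d hd rd] := H' N b hb; exists d => //.
apply: trun_weak (trun_while1 _ rb rd) _ _ _ => //.
  by rewrite (on_top_rep _ _ ha).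
by rewrite mulSn mulnDl -[X in X <= _]add1n leq_add.
Qed.

(** A for-loop rule: [ys] is the processed part in reverse, [xs] the remainder. The type [A] is
    arbitrary because one round may consume a whole clause, that is several items. The equation with
    [tot] lets a round bound its time by global sizes. *)
Lemma exec_each A (r : reg) (p : pred (option token)) M
    (E : seq A -> seq A -> env) (tot : seq A) t :
  (forall ys x xs, rev ys ++ x :: xs = tot -> p (tag (get (E ys (x :: xs)) r))) ->
  (~~ p (tag (get (E (rev tot) [::]) r))) ->
  (forall ys x xs, rev ys ++ x :: xs = tot ->
    exec M (E ys (x :: xs)) (E (x :: ys) xs) t) ->
  exec (While (on_top r p) M) (E [::] tot) (E (rev tot) [::]) (size tot * t.+1 + 1).
Proof.
move=> h1 h0 hM.
suff H xs ys : rev ys ++ xs = tot -> exec (While (on_top r p) M) (E ys xs)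
    (E (rev tot) [::]) (size xs * t.+1 + 1) by apply: H.
elim: xs ys => [|x xs IH] ys e.
  move: e; rewrite cats0 => e; have -> : ys = rev tot by rewrite -e revK.
  exact: exec_while0.
apply: exec_le (exec_while1 (h1 _ _ _ e) (hM _ _ _ e) (IH _ _)) _.
  by rewrite rev_cons cat_rcons.
by rewrite /=; lia.
Qed.

Lemma cells_flat_cons i xs :
  cells (flat (i :: xs)) = Some (inl i.1) :: cells i.2 ++ cells (flat xs).
Proof. by rewrite /flat /= /cells map_cat. Qed.

Lemma head_flat N xs : all (good N) xs -> ~~ word_cell (head None (cells (flat xs))).
Proof. by case: xs => //= i xs /andP[/and3P[h _ _] _]; rewrite negbK. Qed.

Section Operations.
Variables (e : env) (r s : reg).

Lemma exec_copy i xs :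
  (r == s) = false -> get e r = i :: xs -> exec (CopyItem r s) e (put e s (i :: get e s)) 1.
Proof.
move=> rs er; apply: exec_canonical => N ls h.
have := proj2 (h r); rewrite er /= => /andP[/and3P[h1 h2 h3] h4].
have [||ls' H] := @trun_copy r s (ls r) i.1 i.2 (cells (flat xs)) (ls s)
  (cells (flat (get e s))) (canonical ls e) (negbT rs) h2 h1 (head_flat h4).
- by rewrite /canonical er cells_flat_cons.
- by [].
exists (upd (canonical ls e) s (ls', cells (flat (i :: get e s)))).
  by apply: rep_upd => //=; rewrite /good h1 h2 h3; case: (h s).
rewrite cells_flat_cons; apply: trun_weak H _ _ _ => //.
by rewrite /cost; move: h3; clear; lia.
Qed.

Lemma exec_drop i xs : get e r = i :: xs -> exec (DropItem r) e (put e r xs) 1.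
Proof.
move=> er; apply: exec_canonical => N ls h.
have := proj2 (h r); rewrite er /= => /andP[/and3P[h1 h2 h3] h4].
have [|l' H] := @trun_drop r (ls r) i.1 i.2 (cells (flat xs)) (canonical ls e)
  h2 (head_flat h4); first by rewrite /canonical er cells_flat_cons.
exists (upd (canonical ls e) r (l', cells (flat xs))).
  exact: rep_upd.
by apply: trun_weak H _ _ _ => //; rewrite /cost; move: h3; clear; lia.
Qed.

Definition SetTag x := Write r (Some (inl x)).

Lemma exec_settag x i xs :
  delim x -> get e r = i :: xs -> exec (SetTag x) e (put e r ((x, i.2) :: xs)) 1.
Proof.
move=> hx er; apply: exec_canonical => N ls h.
have := proj2 (h r); rewrite er /= => /andP[/and3P[h1 h2 h3] h4].
exists (upd (canonical ls e) r (ls r, cells (flat ((x, i.2) :: xs)))).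
  by apply: rep_upd => //=; rewrite /good hx h2 h3.
apply: trun_weak (trun_write _ _ _) _ _ _ => //.
by rewrite /canonical er !cells_flat_cons.
Qed.

Lemma exec_push x :
  delim x -> exec (Push r x) e (put e r ((x, [::]) :: get e r)) 1.
Proof.
move=> hx; apply: exec_canonical => N ls h.
exists (upd (canonical ls e) r (behead (ls r), cells (flat ((x, [::]) :: get e r)))).
  by apply: rep_upd => //=; rewrite /good hx; case: (h r).
by apply: trun_weak (trun_push _ _ _) _ _ _ => //; rewrite /cost; lia.
Qed.

Lemma exec_ifeq i xs k ys M M' e' t : (r == s) = false ->
  get e r = i :: xs -> get e s = k :: ys ->
  exec (if i.2 == k.2 then M else M') e e' t -> exec (IfEq r s M M') e e' t.+1.
Proof.
move=> rs er es [H]; split=> N a ha.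
pose a' := canonical (fun j => (a j).1) e.
have ea : ceq a a' by move=> j; case: (ha j).
have ra : rep N a' e by move=> j; split=> //; case: (ha j).
have := proj2 (ha r); rewrite er /= => /andP[/and3P[h1 h2 h3] h4].
have := proj2 (ha s); rewrite es /= => /andP[/and3P[k1 k2 k3] k4].
have [b hb rb] := H N a' ra; exists b => //.
apply: trun_weak (trun_ifeq (negbT rs) h2 k2 h1 k1 (head_flat h4) (head_flat k4)
  _ _ rb) _ _ _ => //.
- by rewrite /a' /canonical er cells_flat_cons.
- by rewrite /a' /canonical es cells_flat_cons.
- by rewrite [t.+1 * _]mulSn; apply: leq_add => //; rewrite /cost; move: h3; clear; lia.
Qed.

Variable c : reg.

Lemma exec_split x f g xs :
  (r == s) = false -> (r == c) = false -> (s == c) = false ->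
  get e r = (x, TOr :: encode_formula f ++ encode_formula g) :: xs ->
  get e s = [::] -> get e c = [::] ->
  exec (SplitOr r s c) e
    (put (put e s [:: (TComma, encode_formula f)]) r
       ((TComma, encode_formula g) :: xs)) 1.
Proof.
move=> rs rc sc er es ec; apply: exec_canonical => N ls h.
have sr : (s == r) = false by rewrite eq_sym.
have cr : (c == r) = false by rewrite eq_sym.
have cs : (c == s) = false by rewrite eq_sym.
have := proj2 (h r); rewrite er /= => /andP[/and3P[/= h1 h2 h3] h4].
have /andP[hf hg] : is_word (encode_formula f) && is_word (encode_formula g).
  by move: h2; rewrite /= /is_word all_cat.
move: h3; rewrite /= size_cat => h3.
set a := canonical ls e.
have ar : a r = (ls r, Some (inl x) :: Some (inl TOr) :: cells (encode_formula f)
    ++ cells (encode_formula g) ++ cells (flat xs)).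
  by rewrite /a /canonical er cells_flat_cons /= /cells map_cat catA.
have as_ : a s = (ls s, [::]) by rewrite /a /canonical es.
have ac : a c = (ls c, [::]) by rewrite /a /canonical ec.
pose lr := Some (inl TOr) :: Some (inl x) :: ls r.
pose R := cells (encode_formula g) ++ cells (flat xs).
pose a1 := upd3 a r (lr, cells (encode_formula f) ++ R)
  s (Some (inl TComma) :: ls s, [::]) c (behead (ls c), nseq 1 mark).
have r1 : trun (MvR r ;; MvR r ;; Write s (Some (inl TComma)) ;; MvR s ;;
  MvL c ;; Write c mark) a a1 6.
  apply: trun_weak (trun_seq (trun_mvr _ _) (trun_seq (trun_mvr _ _)
    (trun_seq (trun_write _ _ _) (trun_seq (trun_mvr _ _) (trun_seq (trun_mvl _ _)
    (trun_write _ _ _)))))) _ _ _ => //.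
  by rewrite /a1 /upd3 /lr /R; by_reg.
pose lr' := rev (cells (encode_formula f)) ++ lr.
pose a2 lc := upd3 a r (lr', R)
  s (rev (cells (encode_formula f)) ++ Some (inl TComma) :: ls s, [::]) c (lc, [::]).
have [_ [lc ->] r2] : split_reaches r s c (fun b => exists lc, b = a2 lc) a1
    (1 + 8 * size (encode_formula f)).
  apply: trun_split_loop => // lc; exists (a2 lc); first by exists lc.
  by apply: trun_while0; rewrite ffunE /upd3 /upd cr cs eqxx.
pose a3 := upd (a2 lc) s (ls s, Some (inl TComma) :: cells (encode_formula f) ++ [::]).
have r3 : trun (Rewind s) (a2 lc) a3 (2 * size (encode_formula f) + 2).
  by apply: trun_rewind => //; rewrite /a2 /upd3 /upd sr eqxx.
have r4 := trun_push r TComma a3.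
exists (upd (upd (upd a c (lc, cells (flat [::]))) s
    (ls s, cells (flat [:: (TComma, encode_formula f)]))) r
    (behead lr', cells (flat ((TComma, encode_formula g) :: xs)))).
  have ge : all (good N) [:: (TComma, encode_formula f)].
    by rewrite /= /good /= hf; move: h3; clear; lia.
  have gg : all (good N) ((TComma, encode_formula g) :: xs).
    by rewrite /= h4 /good /= hg; move: h3; clear; lia.
  move=> j; have := rep_upd r (behead lr') (rep_upd s (ls s)
    (rep_upd c lc h (xs := [::]) isT) ge) gg.
  (* The counter register is empty afterwards as it was before, so its update does not show in the
     environment. *)
  move=> /(_ j); rewrite !get_put; case: (eqVneq j c) => // ->.
  by rewrite ec.
apply: trun_weak (trun_seq r1 (trun_seq r2 (trun_seq r3 r4))) _ _ _ => //.
- by rewrite /a3 /a2 /upd3 /R !cells_flat_cons; by_reg.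
- by rewrite /cost; move: h3; clear; lia.
Qed.

End Operations.

(** * Programs *)

Lemma exec_pre M e1 e2 e' t :
  (forall j, get e1 j = get e2 j) -> exec M e1 e' t -> exec M e2 e' t.
Proof. by move=> he [H]; split=> N a ha; apply: H => j; rewrite he. Qed.

Lemma exec_to M e e' e'' t t' :
  exec M e e' t -> e' = e'' -> t <= t' -> exec M e e'' t'.
Proof. by move=> H <-; apply: exec_le H. Qed.

Definition is_comma (o : option token) : bool :=
  if o is Some TComma then true else false.
Definition is_clause_tag (o : option token) : bool :=
  if o is Some (TComma | TArrow) then true else false.

Notation Each r M := (While (on_top r isSome) M).
Notation WhileComma r M := (While (on_top r is_comma) M).
(** Moving a list from stack to stack reverses it. Passes therefore come in pairs, or the reversal
    is kept, which explains the occurrences of [rev] in the specifications below. *)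
Definition Flush r s := Each r (CopyItem r s ;; DropItem r).
Definition Flush2 r s u := Each r (CopyItem r s ;; CopyItem r u ;; DropItem r).
Definition Clear r := Each r (DropItem r).

Lemma exec_flush r s e : (r == s) = false ->
  exec (Flush r s) e (put (put e r [::]) s (rev (get e r) ++ get e s))
    (3 * size (get e r) + 1).
Proof.
move=> rs; have sr : (s == r) = false by rewrite eq_sym.
pose E ys xs := put (put e r xs) s (ys ++ get e s).
apply: (@exec_pre _ (E [::] (get e r))) => [j|].
  by rewrite /E !get_put; case: eqP => [->|] //; case: eqP => [->|].
rewrite mulnC; apply: (@exec_each _ r isSome _ E) => [ys x xs _|| ys x xs _].
- by rewrite /E !get_put rs eqxx.
- by rewrite /E !get_put rs eqxx.
have er : get (E ys (x :: xs)) r = x :: xs by rewrite /E !get_put rs eqxx.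
apply: exec_weak (exec_seq (exec_copy rs er) (exec_drop (xs := xs) _)) _ _ => //.
  by rewrite /E !get_put rs eqxx.
move=> j; rewrite /E !get_put ?sr ?rs ?eqxx.
by case: (eqVneq j r) => [->|_]; rewrite ?rs ?eqxx //; case: eqP.
Qed.

Lemma exec_flush2 r s u e :
  (r == s) = false -> (r == u) = false -> (s == u) = false ->
  exec (Flush2 r s u) e
    (put (put (put e r [::]) s (rev (get e r) ++ get e s))
       u (rev (get e r) ++ get e u))
    (4 * size (get e r) + 1).
Proof.
move=> rs ru su; have sr : (s == r) = false by rewrite eq_sym.
have ur : (u == r) = false by rewrite eq_sym.
have us : (u == s) = false by rewrite eq_sym.
pose E ys xs := put (put (put e r xs) s (ys ++ get e s)) u (ys ++ get e u).
apply: (@exec_pre _ (E [::] (get e r))) => [j|].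
  rewrite /E !get_put; case: eqP => [->|] //; case: eqP => [->|] //.
  by case: eqP => [->|].
rewrite mulnC; apply: (@exec_each _ r isSome _ E) => [ys x xs _|| ys x xs _].
- by rewrite /E !get_put rs ru eqxx.
- by rewrite /E !get_put rs ru eqxx.
have er : get (E ys (x :: xs)) r = x :: xs by rewrite /E !get_put rs ru eqxx.
apply: exec_weak (exec_seq (exec_copy rs er) (exec_seq (exec_copy ru (i := x) (xs := xs) _)
  (exec_drop (xs := xs) _))) _ _ => //; try by rewrite /E !get_put ?rs ?ru eqxx.
move=> j; rewrite /E !get_put ?sr ?ur ?su ?us ?rs ?ru ?eqxx.
case: (eqVneq j r) => [->|_]; rewrite ?rs ?ru ?eqxx //.
by case: (eqVneq j s) => [->|_]; rewrite ?su //; case: eqP.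
Qed.

Lemma exec_clear r e : exec (Clear r) e (put e r [::]) (2 * size (get e r) + 1).
Proof.
pose E (ys xs : seq item) := put e r xs.
apply: (@exec_pre _ (E [::] (get e r))) => [j|].
  by rewrite !get_put; case: eqP => [->|].
rewrite mulnC; apply: (@exec_each _ r isSome _ E) => [ys x xs _|| ys x xs _].
- by rewrite /E !get_put eqxx.
- by rewrite /E !get_put eqxx.
apply: exec_weak (exec_drop (i := x) (xs := xs) _) _ _ => //.
  by rewrite /E get_put eqxx.
by move=> j; rewrite /E !get_put; case: eqP.
Qed.

(* Closing brackets of the output (initially the input, finally the whole
   output), scratch, clauses (later the second disjunct), pending clauses,
   known formulas, first disjunct, log, antecedent read, failure and success
   marks, current antecedent (initially a counter), goal, output. *)
Definition rZ : reg := @Ordinal 13 0 isT.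
Definition rT : reg := @Ordinal 13 1 isT.
Definition rW : reg := @Ordinal 13 2 isT.
Definition rX : reg := @Ordinal 13 3 isT.
Definition rK : reg := @Ordinal 13 4 isT.
Definition rA : reg := @Ordinal 13 5 isT.
Definition rL : reg := @Ordinal 13 6 isT.
Definition rB : reg := @Ordinal 13 7 isT.
Definition rF : reg := @Ordinal 13 8 isT.
Definition rH : reg := @Ordinal 13 9 isT.
Definition rD : reg := @Ordinal 13 10 isT.
Definition rG : reg := @Ordinal 13 11 isT.
Definition rO : reg := @Ordinal 13 12 isT.

Definition clause : Type := (seq formula * formula)%type.
Definition bitems (b : seq formula) : seq item :=
  [seq (TComma, encode_formula f) | f <- b].
Definition citems (c : clause) : seq item :=
  bitems c.1 ++ [:: (TArrow, encode_formula c.2)].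
(** In the log the succedent comes first, because the backward reading decides on it before looking
    at the antecedent. The arrow also stops a loop over the commas of the preceding entry. *)
Definition litem (c : clause) : seq item :=
  (TArrow, encode_formula c.2) :: bitems c.1.
Definition marks n : seq item := nseq n (TOpen, [::]).

Ltac op H := eapply exec_seq; [eapply H; reflexivity | rewrite /put /=].
Ltac op_last H := eapply H; reflexivity.

(** Keeping only comma and arrow items forgets the tree structure of the derivation. The copy in
    [rD] is a unary counter: each of its items causes one more copy of the clause list on [rX]. *)
Definition Prepare :=
  Each rZ (If (on_top rZ is_clause_tag)
             (CopyItem rZ rT) Nop ;; DropItem rZ) ;;
  Flush2 rT rW rD ;;
  Each rD (DropItem rD ;; Flush rW rT ;; Flush2 rT rW rX).

Definition in_clause (i : item) : bool := is_clause_tag (Some i.1).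

Notation e0 := [::] (only parsing).

Lemma exec_prepare (xs : seq item) :
  let ws := filter in_clause xs in
  exec Prepare [:: xs; e0; e0; e0; e0; e0; e0; e0; e0; e0; e0; e0; e0]
    [:: e0; e0; ws; flatten (nseq (size ws) ws); e0; e0; e0; e0; e0; e0; e0; e0; e0]
    (20 * (size xs).+1 * (size xs).+1).
Proof.
move=> ws.
have lw : size ws <= size xs by rewrite size_filter count_size.
eapply exec_to.
- eapply exec_seq.
  + pose E (ys zs : seq item) : env :=
      [:: zs; filter in_clause ys; e0; e0; e0; e0; e0; e0; e0; e0; e0; e0; e0].
    apply: (@exec_each _ rZ isSome _ E xs 4) => // ys x zs _.
    eapply exec_to; [eapply exec_seq; [apply: (@exec_if _ _ _ _
      (E ys (x :: zs)) (put (E ys (x :: zs)) rT (filter in_clause (x :: ys))) 1)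
      | op_last (@exec_drop)] | by rewrite /put /= | by []].
    rewrite /E /get /put /=; case hx: (in_clause x); rewrite /in_clause /= in hx; rewrite hx.
      by eapply exec_to; [op_last (@exec_copy) | |].
    by apply: exec_nop.
  + eapply exec_seq; first by apply: (@exec_flush2 rT rW rD).
    rewrite /put /get /= cats0 filter_rev revK -/ws.
    pose E (ys zs : seq item) : env :=
      [:: e0; e0; ws; flatten (nseq (size ys) ws); e0; e0; e0; e0; e0; e0; zs; e0; e0].
    apply: (@exec_each _ rD isSome _ E ws (7 * size ws + 3)) => // ys x zs _.
    rewrite /E; eapply exec_to; [op (@exec_drop)
      ; eapply exec_seq; [apply: (@exec_flush rW rT); reflexivity | rewrite /put /get /= cats0]
      ; by apply: (@exec_flush2 rT rW rX) | by rewrite /put /get /= cats0 revK |].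
    by rewrite /get /= size_rev; move: (size ws); clear; lia.
- by rewrite /= size_rev.
- rewrite /get /= filter_rev size_rev -/ws.
  move: lw; move: (size ws) (size xs); clear => m n lmn; nia.
Qed.

(** The root is written first in an encoding, so the first clause is the end sequent: its antecedent
    becomes the initial list of known formulas, and the loop halts at the arrow in front of the
    disjunction. *)
Definition Setup :=
  WhileComma rW (CopyItem rW rK ;; DropItem rW) ;; SplitOr rW rA rH.

Lemma exec_setup g f1 f2 ws X :
  exec Setup
    [:: e0; e0; citems (g, Or f1 f2) ++ ws; X; e0; e0; e0; e0; e0; e0; e0; e0; e0]
    [:: e0; e0; (TComma, encode_formula f2) :: ws; X; bitems (rev g);
        [:: (TComma, encode_formula f1)]; e0; e0; e0; e0; e0; e0; e0]
    (3 * size g + 2).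
Proof.
eapply exec_to.
- eapply exec_seq.
    pose E (ys zs : seq formula) : env :=
      [:: e0; e0; bitems zs ++ (TArrow, encode_formula (Or f1 f2)) :: ws; X;
          bitems ys; e0; e0; e0; e0; e0; e0; e0; e0].
    apply: (@exec_pre _ (E [::] g)) => [j|].
      by rewrite /E /citems -catA.
    apply: (@exec_each _ rW is_comma _ E g 2) => // ys x zs _.
    rewrite /E; eapply exec_to; [op exec_copy; op_last exec_drop | by [] | by []].
  by eapply exec_split; reflexivity.
- by [].
- by clear; lia.
Qed.

(** * Membership tests and forward chaining *)

Definition Member :=
  Flush rK rT ;;
  Each rT (CopyItem rT rK ;; IfEq rX rT (Push rH TOpen) Nop ;; DropItem rT).

(** Unique readability of prefix notation. The arbitrary continuations let the induction pass from
    the first argument of a connective to the second; [TEnd] separates an atom name from what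
    follows. *)
Lemma encode_inj_cat f g s t :
  encode_formula f ++ s = encode_formula g ++ t -> f = g /\ s = t.
Proof.
have aux (u v : seq bool) s' t' : map TBit u ++ TEnd :: s' = map TBit v ++ TEnd :: t' ->
    u = v /\ s' = t'.
  elim: u v => [|x u IH] [|y v] //=; first by case.
  by case=> -> /IH[-> ->].
elim: f g s t => [u||f IHf g IHg|f IHf g IHg|f IHf g IHg]
  [v||f' g'|f' g'|f' g'] s t //=.
- by rewrite -!catA /= => -[/aux[-> ->]].
- by case.
all: by rewrite -!catA => -[/IHf[-> /IHg[-> ->]]].
Qed.

Lemma encode_inj : injective encode_formula.
Proof.
by move=> f g e; case: (@encode_inj_cat f g [::] [::]); rewrite ?cats0.
Qed.

Lemma is_word_encode f : is_word (encode_formula f).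
Proof.
rewrite /is_word; elim: f => //= [u|f IHf g IHg|f IHf g IHg|f IHf g IHg];
  rewrite all_cat ?IHf ?IHg //= andbT.
by elim: u.
Qed.

Lemma exec_member T0 Z W x f X ks A L B F H D G O :
  T0 = [::] ->
  exec Member
    [:: Z; T0; W; (x, encode_formula f) :: X; bitems ks; A; L; B; F; H; D; G; O]
    [:: Z; e0; W; (x, encode_formula f) :: X; bitems ks; A; L; B; F;
        marks (count_mem f ks) ++ H; D; G; O]
    (8 * size ks + 2).
Proof.
move=> ->; eapply exec_to.
- eapply exec_seq; first by apply: (@exec_flush rK rT).
  rewrite /put /get /= cats0 -map_rev.
  pose E (ys zs : seq formula) : env :=
    [:: Z; bitems zs; W; (x, encode_formula f) :: X; bitems ys; A; L; B; F;
        marks (count_mem f ys) ++ H; D; G; O].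
  apply: (@exec_each _ rT isSome _ E (rev ks) 4) => // ys y zs _.
  rewrite /E; eapply exec_to; [op exec_copy; eapply (@exec_seq _ _ _
    [:: Z; (TComma, encode_formula y) :: bitems zs; W;
      (x, encode_formula f) :: X; (TComma, encode_formula y) :: bitems ys; A; L; B; F;
        marks ((y == f) + count_mem f ys) ++ H; D; G; O]) | |].
  + eapply exec_ifeq; [by []|reflexivity|reflexivity|].
    rewrite /= (inj_eq encode_inj).
    case: (eqVneq f y) => [->|ne].
      by eapply exec_to; [op_last exec_push | by rewrite /put /= ?eqxx | exact: leqnn].
    by eapply exec_to; [apply: exec_nop| by rewrite ?(negPf ne) | exact: leqnn].
  + by op_last (@exec_drop).
  + by [].
  + by [].
- by rewrite /= revK.
- by rewrite /get /= size_rev size_map; clear; lia.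
Qed.

(** Success marks are erased after each hypothesis, whereas failure marks accumulate: [rF] is empty
    at the arrow exactly when all hypotheses are known. *)
Definition ReadBody :=
  WhileComma rX (Member ;; If (on_top rH isSome) (Clear rH) (Push rF TOpen) ;;
    CopyItem rX rB ;; DropItem rX).
(** A log entry is built from the bottom, antecedent first and succedent on top. The copy added to
    the known formulas is retagged, as these carry commas. *)
Definition Fire :=
  If (on_top rF isSome) (Clear rF ;; Clear rB)
    (Flush rB rL ;; CopyItem rX rL ;; CopyItem rX rK ;; SetTag rK TComma).
Definition Forward := Each rX (ReadBody ;; Fire ;; DropItem rX).

Lemma exec_readbody W h X ks A L b :
  exec ReadBody
    [:: e0; e0; W; bitems b ++ (TArrow, h) :: X; bitems ks; A; L; e0; e0; e0; e0; e0; e0]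
    [:: e0; e0; W; (TArrow, h) :: X; bitems ks; A; L; bitems (rev b);
        marks (count [predC ks] b); e0; e0; e0; e0]
    (size b * (10 * size ks + 11) + 1).
Proof.
pose E (ys zs : seq formula) : env :=
  [:: e0; e0; W; bitems zs ++ (TArrow, h) :: X; bitems ks; A; L; bitems ys;
      marks (count [predC ks] ys); e0; e0; e0; e0].
eapply exec_to; first apply: (@exec_each _ rX is_comma _ E b (10 * size ks + 10)) => //.
- move=> ys f zs _; rewrite /E; eapply exec_to.
  + eapply exec_seq; first by apply: exec_member.
    eapply (@exec_seq _ _ _ [:: e0; e0; W; bitems (f :: zs) ++ (TArrow, h) :: X; bitems ks;
      A; L; bitems ys; marks (count [predC ks] (f :: ys)); e0; e0; e0; e0] _ (2 * size ks + 1).+1).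
      apply: exec_if; rewrite /= cats0.
      have := count_size (pred1 f) ks; have := has_count (pred1 f) ks; rewrite has_pred1.
      case E1: (count_mem f ks) => [|k] hk lk; rewrite /= ?hk /=.
        by eapply exec_to; [op_last exec_push | by [] | by clear; lia].
      eapply exec_to; [exact: exec_clear | by [] |].
      by rewrite /get /= size_nseq leq_add2r leq_mul2l.
    by op exec_copy; op_last exec_drop.
  + by [].
  + by clear; lia.
- by rewrite /E count_rev.
- by move: (size b) (size ks); clear; lia.
Qed.

Definition fires (ks : seq formula) (c : clause) : bool := all (mem ks) c.1.

Lemma exec_fire W h X ks A L b :
  exec Fire
    [:: e0; e0; W; (TArrow, encode_formula h) :: X; bitems ks; A; L; bitems (rev b);
        marks (count [predC ks] b); e0; e0; e0; e0]
    (if fires ks (b, h) then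
       [:: e0; e0; W; (TArrow, encode_formula h) :: X; bitems (h :: ks); A;
           litem (b, h) ++ L; e0; e0; e0; e0; e0; e0]
     else
       [:: e0; e0; W; (TArrow, encode_formula h) :: X; bitems ks; A; L;
           e0; e0; e0; e0; e0; e0])
    (4 * size b + 5).
Proof.
have -> : fires ks (b, h) = (count [predC ks] b == 0).
  rewrite /fires -[all _ _]negbK -has_predC has_count lt0n negbK.
  by congr (_ == 0); apply: eq_count.
case: (count [predC ks] b) (count_size [predC ks] b) => [|k] lk /=.
  eapply exec_to; first (eapply exec_if; rewrite /=).
  - eapply exec_seq; first by apply: (@exec_flush rB rL).
    by rewrite /put /=; op exec_copy; op exec_copy; op_last exec_settag.
  - by rewrite /put /get /litem /= -map_rev revK.
  - by rewrite /get /= size_map size_rev; clear; lia.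
eapply exec_to; first (eapply exec_if; rewrite /=).
- by eapply exec_seq; apply: exec_clear.
- by [].
- rewrite /get /= size_nseq size_map size_rev.
  by move: lk; clear; move: (size b) => n; lia.
Qed.

Definition heads (ls : seq clause) : seq formula := [seq c.2 | c <- ls].

(* Forward chaining from [g]; [cs] lists the clauses already processed, the
   latest one first, and so does the result for those that fired. *)
Definition forward (g : seq formula) (cs : seq clause) : seq clause :=
  foldr (fun c ls => if fires (heads ls ++ g) c then c :: ls else ls) [::] cs.

Lemma size_forward g cs : size (forward g cs) <= size cs.
Proof. by elim: cs => //= c cs IH; case: ifP => _ //=; apply: leq_trans IH _. Qed.

Lemma forward_sub g cs : {subset forward g cs <= cs}.
Proof.
move=> c; elim: cs => //= c' l IH.
by case: ifP => _; rewrite !inE; [case/orP => [->|/IH ->] | move=> /IH ->]; rewrite ?orbT.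
Qed.

Definition all_items (T : Type) (f : T -> seq item) (cs : seq T) := flatten (map f cs).

Lemma exec_forward W A g cs m :
  all (fun c : clause => size c.1 <= m) cs ->
  exec Forward
    [:: e0; e0; W; all_items citems cs; bitems g; A; e0; e0; e0; e0; e0; e0; e0]
    (let ls := forward g (rev cs) in
     [:: e0; e0; W; e0; bitems (heads ls ++ g); A; all_items litem ls;
         e0; e0; e0; e0; e0; e0])
    (size cs * (m * (10 * (size cs + size g) + 11) + 4 * m + 8) + 1).
Proof.
move=> hm.
pose E (ys zs : seq clause) : env := let ls := forward g ys in
  [:: e0; e0; W; all_items citems zs; bitems (heads ls ++ g); A; all_items litem ls;
         e0; e0; e0; e0; e0; e0].
eapply exec_to; first apply: (@exec_each _ rX isSome _ E cs
  (m * (10 * (size cs + size g) + 11) + 4 * m + 7)) => //.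
- by move=> ys [[|f b] h] zs _.
- move=> ys [b h] zs tot; rewrite /E.
  set ls := forward g ys; have -> : forward g ((b, h) :: ys) =
    if fires (heads ls ++ g) (b, h) then (b, h) :: ls else ls by [].
  have lb : size b <= m.
    by move: hm; rewrite -tot all_cat /= => /and3P[_ ->].
  have ll : size (heads ls ++ g) <= size cs + size g.
    rewrite size_cat size_map leq_add2r (leq_trans (size_forward _ _)) //.
    by rewrite -tot size_cat size_rev leq_addr.
  have -> : all_items citems ((b, h) :: zs) =
      bitems b ++ (TArrow, encode_formula h) :: all_items citems zs.
    by rewrite /all_items /= /citems -catA.
  have aux n k s : n <= m -> k <= s -> n * (10 * k + 11) + 1 + (4 * n + 5 + 1) <=
      m * (10 * s + 11) + 4 * m + 7.
    clear=> l1 l2.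
    have : n * (10 * k + 11) <= m * (10 * s + 11) by apply: leq_mul => //; lia.
    lia.
  have := exec_fire W h (all_items citems zs) (heads ls ++ g) A (all_items litem ls) b.
  by case: ifP => _ hf; (eapply exec_to; [eapply exec_seq; [exact: exec_readbody |
    eapply exec_seq; [exact: hf | op_last exec_drop]] | by [] | exact: aux]).
- by [].
- by rewrite leq_add2r leq_mul2l -addn1 -addnA leqnn orbT.
Qed.

(** * Cuts *)

(** The first disjunct is in [rA], the second on top of [rW]. When a goal is found, [rD] holds the
    antecedent of its sequent and [rL] exactly the older entries, which are those that may support
    it. *)
Definition Find :=
  While (on_top rG (fun o => ~~ isSome o))
    (Clear rD ;;
     IfEq rL rA (CopyItem rL rG) (IfEq rL rW (CopyItem rL rG) Nop) ;;
     DropItem rL ;;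
     WhileComma rL (CopyItem rL rD ;; DropItem rL)).

Lemma tag_litems ls : ~~ is_comma (tag (all_items litem ls)).
Proof. by case: ls. Qed.

Lemma exec_find_step f1 f2 ws K b h ls d :
  exec (Clear rD ;;
     IfEq rL rA (CopyItem rL rG) (IfEq rL rW (CopyItem rL rG) Nop) ;;
     DropItem rL ;; WhileComma rL (CopyItem rL rD ;; DropItem rL))
    [:: e0; e0; (TComma, encode_formula f2) :: ws; e0; K; [:: (TComma, encode_formula f1)];
        all_items litem ((b, h) :: ls); e0; e0; e0; bitems d; e0; e0]
    [:: e0; e0; (TComma, encode_formula f2) :: ws; e0; K; [:: (TComma, encode_formula f1)];
        all_items litem ls; e0; e0; e0; bitems (rev b);
        if (h == f1) || (h == f2) then [:: (TArrow, encode_formula h)] else e0; e0]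
    (2 * size d + 3 * size b + 6).
Proof.
set G' := if _ then _ else _.
eapply exec_to.
- eapply exec_seq; first by apply: exec_clear.
  rewrite /put /=; eapply (@exec_seq _ _ _
    [:: e0; e0; (TComma, encode_formula f2) :: ws; e0; K; [:: (TComma, encode_formula f1)];
        all_items litem ((b, h) :: ls); e0; e0; e0; e0; G'; e0] _ 3).
    eapply exec_ifeq; [by []|reflexivity|reflexivity|].
    rewrite /= (inj_eq encode_inj) /G'; case: (h == f1) => /=.
      by eapply exec_to; [op_last exec_copy | by [] | by []].
    eapply exec_ifeq; [by []|reflexivity|reflexivity|].
    rewrite /= (inj_eq encode_inj); case: (h == f2) => /=.
      by eapply exec_to; [op_last exec_copy | by [] | by []].
    exact: exec_nop.
  op exec_drop.
  pose E (ys zs : seq formula) : env :=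
    [:: e0; e0; (TComma, encode_formula f2) :: ws; e0; K; [:: (TComma, encode_formula f1)];
        bitems zs ++ all_items litem ls; e0; e0; e0; bitems ys; G'; e0].
  apply: (@exec_each _ rL is_comma _ E b 2) => // [|ys x zs _]; first exact: tag_litems.
  by rewrite /E; eapply exec_to; [op exec_copy; op_last exec_drop | by [] | by []].
- by [].
- by rewrite /get /= size_map; move: (size b) (size d); clear; lia.
Qed.

Lemma exec_find f1 f2 ws K pre b h post d m :
  all (fun c : clause => (c.2 != f1) && (c.2 != f2)) pre -> (h == f1) || (h == f2) ->
  all (fun c : clause => size c.1 <= m) (pre ++ [:: (b, h)]) -> size d <= m ->
  exec Find
    [:: e0; e0; (TComma, encode_formula f2) :: ws; e0; K; [:: (TComma, encode_formula f1)];
        all_items litem (pre ++ (b, h) :: post); e0; e0; e0; bitems d; e0; e0]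
    [:: e0; e0; (TComma, encode_formula f2) :: ws; e0; K; [:: (TComma, encode_formula f1)];
        all_items litem post; e0; e0; e0; bitems (rev b); [:: (TArrow, encode_formula h)]; e0]
    ((size pre).+1 * (5 * m + 7) + 1).
Proof.
move=> + hh; elim: pre d => [|[b' h'] pre IH] d /=.
  move=> _ /andP[lb _] ld; have := exec_find_step f1 f2 ws K b h post d.
  rewrite hh => H; eapply exec_to; first (eapply exec_while1; [by [] | exact: H |]).
  - exact: exec_while0.
  - by [].
  - suff aux x y : x <= m -> y <= m ->
      (2 * x + 3 * y + 6 + 1).+1 <= 1 * (5 * m + 7) + 1 by apply: aux.
    by clear; lia.
move=> /andP[/andP[n1 n2] hp] /andP[lb hm] ld.
have := exec_find_step f1 f2 ws K b' h' (pre ++ (b, h) :: post) d.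
rewrite (negPf n1) (negPf n2) => H.
eapply exec_to; first (eapply exec_while1; [by [] | exact: H | apply: IH => //]).
- by rewrite size_rev.
- by [].
- suff aux x y z : x <= m -> y <= m ->
    (2 * x + 3 * y + 6 + (z + 1)).+1 <= (5 * m + 7) + z + 1 by apply: aux.
  by clear; lia.
Qed.

(** * Deductions as lists of items *)

Fixpoint items_of_tree (t : tree clause) : seq item :=
  let: Node c ts := t in
  (TOpen, [::]) :: citems c ++ flatten (map items_of_tree ts) ++ [:: (TClose, [::])].

(* A deduction whose every cut has a leaf as left premise ends with closing
   brackets only, hence can be output by prepending to [front t] and counting
   these brackets separately. *)
Fixpoint front (t : tree clause) : seq item :=
  match t with
  | Node c [:: t0; t1] =>
      (TOpen, [::]) :: citems c ++ items_of_tree t0 ++ front t1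
  | _ => items_of_tree t
  end.

Fixpoint right_depth (t : tree clause) : nat :=
  if t is Node _ [:: _; t1] then (right_depth t1).+1 else 0.

Definition closings n : seq item := nseq n (TClose, [::]).

Lemma closingsS n : closings n.+1 = closings n ++ [:: (TClose, [::])].
Proof. by rewrite /closings -addn1 nseqD. Qed.

Lemma nested_tree_ind A (P : tree A -> Prop) :
  (forall x ts, (forall t, List.In t ts -> P t) -> P (Node x ts)) -> forall t, P t.
Proof.
move=> H; fix IH 1; case=> x ts; apply: H.
elim: ts => [t []|t ts IHts t' [<-|]]; [exact: IH | exact: IHts].
Qed.

Lemma front_closings t : front t ++ closings (right_depth t) = items_of_tree t.
Proof.
elim/nested_tree_ind: t => c [|t0 [|t1 [|t2 ts]]] IH; rewrite ?cats0 //.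
have e1 := IH t1 (or_intror (or_introl erefl)).
transitivity (front (Node c [:: t0; t1]) ++ closings (right_depth t1).+1) => //.
rewrite closingsS /= -e1 cats0.
by rewrite -!catA.
Qed.

Definition remove (h : formula) (d : seq formula) := [seq f <- d | f != h].

(** All occurrences of the cut formula are removed, as befits sets; it stays in the result only if
    the antecedent of [c] contains it. The order of the lists, including [rev c.1], is the one in
    which the stacks leave them. *)
Definition cut_with (g : formula) (c : clause) (t : tree clause) : tree clause :=
  let d := (tree_root t).1 in
  if c.2 \in d then Node (remove c.2 d ++ c.1, g) [:: Node (rev c.1, c.2) [::]; t]
  else t.

Definition cut_all (g : formula) (d : seq formula) (cs : seq clause) : tree clause :=
  foldr (cut_with g) (Node (d, g) [::]) cs.

Lemma cut_all_root g d cs : (tree_root (cut_all g d cs)).2 = g.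
Proof. by elim: cs => //= c cs IH; rewrite /cut_with; case: ifP. Qed.

(** Duplicates are never contracted, but each cut adds at most one antecedent of the input, so the
    growth is linear in the number of cuts. *)
Lemma size_cut_all g d cs m :
  size d <= m -> all (fun c : clause => size c.1 <= m) cs ->
  size (tree_root (cut_all g d cs)).1 <= (size cs).+1 * m.
Proof.
move=> ld; elim: cs => [|c cs IH] /=; first by rewrite mul1n.
move=> /andP[lc /IH {}IH]; rewrite /cut_with; case: ifP => _ /=; last first.
  by apply: leq_trans IH _; rewrite leq_mul2r leqnSn orbT.
rewrite size_cat mulSn addnC leq_add // (leq_trans _ IH) //.
by rewrite size_filter count_size.
Qed.

Definition Leaf :=
  Push rO TClose ;; CopyItem rG rO ;; Flush rD rT ;; Flush2 rT rD rO ;; Push rO TOpen.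

Definition RemoveHead :=
  Each rD (IfEq rL rD (Push rF TOpen) (CopyItem rD rB) ;; DropItem rD).

(** The output stack is written from its end, so in front of the right premise comes the left leaf
    and then the conclusion. The bracket closing the cut belongs behind everything written so far
    and is kept in [rZ]. *)
Definition Cuts :=
  Each rL (RemoveHead ;;
    If (on_top rF isSome)
      (Clear rF ;; Push rZ TClose ;; Push rO TClose ;; CopyItem rL rO ;; DropItem rL ;;
       WhileComma rL (CopyItem rL rO ;; CopyItem rL rB ;; DropItem rL) ;;
       Push rO TOpen ;; CopyItem rG rO ;; Flush2 rB rD rO ;; Push rO TOpen)
      (Flush rB rD ;; DropItem rL ;; WhileComma rL (DropItem rL))).

Lemma exec_leaf W K A L d g :
  exec Leaf
    [:: e0; e0; W; e0; K; A; L; e0; e0; e0; bitems d; [:: (TArrow, encode_formula g)]; e0]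
    [:: e0; e0; W; e0; K; A; L; e0; e0; e0; bitems d; [:: (TArrow, encode_formula g)];
        front (Node (d, g) [::])]
    (7 * size d + 5).
Proof.
eapply exec_to.
- op exec_push; op exec_copy.
  eapply exec_seq; first by apply: exec_flush.
  rewrite /put /=; eapply exec_seq; first by apply: exec_flush2.
  by rewrite /put /=; op_last exec_push.
- by rewrite /put /get /= !cats0 revK /citems /= -catA.
- by rewrite /get /= cats0 size_rev size_map; clear; lia.
Qed.

Lemma exec_remove Z W K A b h L d G O :
  exec RemoveHead
    [:: Z; e0; W; e0; K; A; all_items litem ((b, h) :: L); e0; e0; e0; bitems d; G; O]
    [:: Z; e0; W; e0; K; A; all_items litem ((b, h) :: L); bitems (rev (remove h d));
        marks (count_mem h d); e0; e0; G; O]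
    (4 * size d + 1).
Proof.
pose E (ys zs : seq formula) : env :=
  [:: Z; e0; W; e0; K; A; all_items litem ((b, h) :: L); bitems (remove h ys);
      marks (count_mem h ys); e0; bitems zs; G; O].
eapply exec_to; first apply: (@exec_each _ rD isSome _ E d 3) => // ys f zs _.
- rewrite /E; eapply exec_to; first eapply (@exec_seq _ _ _
    [:: Z; e0; W; e0; K; A; all_items litem ((b, h) :: L); bitems (remove h (f :: ys));
      marks (count_mem h (f :: ys)); e0; bitems (f :: zs); G; O] _ 2).
  + eapply exec_ifeq; [by []|reflexivity|reflexivity|].
    rewrite /= (inj_eq encode_inj); case: (eqVneq h f) => [->|ne].
      by eapply exec_to; [op_last exec_push | by rewrite /put /= ?eqxx | by []].
    eapply exec_to; [op_last exec_copy | | by []].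
    by rewrite /put /= ?(negPf ne) ?ne 1?eq_sym ?ne.
  + by op_last exec_drop.
  + by [].
  + by [].
- by rewrite /E count_rev /remove filter_rev.
- by rewrite mulnC.
Qed.

Lemma exec_cut_step W K A b h L g (t : tree clause) :
  (tree_root t).2 = g ->
  let st L t := [:: closings (right_depth t); e0; W; e0; K; A; all_items litem L; e0; e0; e0;
    bitems (tree_root t).1; [:: (TArrow, encode_formula g)]; front t] in
  exec (RemoveHead ;;
    If (on_top rF isSome)
      (Clear rF ;; Push rZ TClose ;; Push rO TClose ;; CopyItem rL rO ;; DropItem rL ;;
       WhileComma rL (CopyItem rL rO ;; CopyItem rL rB ;; DropItem rL) ;;
       Push rO TOpen ;; CopyItem rG rO ;; Flush2 rB rD rO ;; Push rO TOpen)
      (Flush rB rD ;; DropItem rL ;; WhileComma rL (DropItem rL)))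
    (st ((b, h) :: L) t) (st L (cut_with g (b, h) t))
    (10 * size (tree_root t).1 + 8 * size b + 20).
Proof.
move=> tg st; rewrite /cut_with /st; set d := (tree_root t).1.
have ld : size (remove h d) <= size d by rewrite size_filter count_size.
have lc := count_size (pred1 h) d.
have := has_count (pred1 h) d; rewrite has_pred1 /=.
case: (count_mem h d) (exec_remove (closings (right_depth t)) W K A b h L d
  [:: (TArrow, encode_formula g)] (front t)) lc => [|k] hr lc hd; rewrite hd /=.
  (* Nothing was removed, so flushing [rB] back restores the antecedent. *)
  have rd : remove h d = d.
    by apply/all_filterP/allP => f fd; apply: contraFneq hd => <-.
  eapply exec_to.
  - eapply exec_seq; first exact: hr.
    eapply exec_if; rewrite /=.
    eapply exec_seq; first by apply: (@exec_flush rB rD).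
    rewrite /put /get /= cats0 -map_rev revK rd; op exec_drop.
    pose E (ys zs : seq formula) : env :=
      [:: closings (right_depth t); e0; W; e0; K; A; bitems zs ++ all_items litem L;
          e0; e0; e0; bitems d; [:: (TArrow, encode_formula g)]; front t].
    apply: (@exec_each _ rL is_comma _ E b 1) => // [|ys x zs _]; first exact: tag_litems.
    by rewrite /E; eapply exec_to; [op_last exec_drop | by [] | by []].
  - by [].
  - rewrite /get /= size_map size_rev rd; move: (size b) (size d); clear; lia.
pose Z' := closings (right_depth t).+1.
eapply exec_to.
- eapply exec_seq; first exact: hr.
  eapply exec_if; rewrite /=.
  eapply exec_seq; first by apply: exec_clear.
  rewrite /put /=; op exec_push; op exec_push; op exec_copy; op exec_drop.
  eapply exec_seq.
    pose E (ys zs : seq formula) : env :=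
      [:: Z'; e0; W; e0; K; A; bitems zs ++ all_items litem L;
          bitems (ys ++ rev (remove h d)); e0; e0; bitems [::];
          [:: (TArrow, encode_formula g)];
          bitems ys ++ [:: (TArrow, encode_formula h), (TClose, [::]) & front t]].
    apply: (@exec_each _ rL is_comma _ E b 3) => // [|ys x zs _]; first exact: tag_litems.
    by rewrite /E; eapply exec_to;
      [op exec_copy; op exec_copy; op_last exec_drop | by [] | by []].
  rewrite /=; op exec_push; op exec_copy.
  eapply exec_seq; first by apply: (@exec_flush2 rB rD rO).
  by rewrite /put /get /=; op_last exec_push.
- rewrite /put /get /= cats0 -map_rev rev_cat !revK /citems /=.
  by rewrite -!catA.
- rewrite /get /= size_nseq size_map size_cat !size_rev.
  suff aux x y z u : x <= z -> u <= z -> 4 * z + 1 + (2 * x + 1 + (1 + (1 + (1 + (1 +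
      (y * 4 + 1 + (1 + (1 + (4 * (y + u) + 1 + 1))))))))).+1 <= 10 * z + 8 * y + 20
    by apply: aux.
  by clear; lia.
Qed.

Lemma cut_all_cons g d c cs : cut_all g d (c :: cs) = cut_with g c (cut_all g d cs).
Proof. by []. Qed.

Lemma exec_cuts W K A g d cs m :
  size d <= m -> all (fun c : clause => size c.1 <= m) cs ->
  let t := cut_all g d (rev cs) in
  exec Cuts
    [:: e0; e0; W; e0; K; A; all_items litem cs; e0; e0; e0;
        bitems d; [:: (TArrow, encode_formula g)]; front (Node (d, g) [::])]
    [:: closings (right_depth t); e0; W; e0; K; A; e0; e0; e0; e0;
        bitems (tree_root t).1; [:: (TArrow, encode_formula g)]; front t]
    (size cs * (10 * ((size cs).+1 * m) + 8 * m + 21) + 1).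
Proof.
move=> ld hm t.
pose E (ys zs : seq clause) : env := let u := cut_all g d ys in
  [:: closings (right_depth u); e0; W; e0; K; A; all_items litem zs; e0; e0; e0;
      bitems (tree_root u).1; [:: (TArrow, encode_formula g)]; front u].
eapply exec_to; first apply: (@exec_each _ rL isSome _ E cs
    (10 * ((size cs).+1 * m) + 8 * m + 20)) => //.
- move=> ys [b h] zs tot; rewrite /E cut_all_cons.
  apply: exec_le; first by apply: exec_cut_step; exact: cut_all_root.
  move: hm; rewrite -tot all_cat all_rev /= => /and3P[hy lb hz].
  have := size_cut_all g ld hy; set x := size _ => hx.
  rewrite leq_add2r leq_add // leq_mul2l //= (leq_trans hx) //.
  by rewrite leq_mul2r ltnS size_cat size_rev leq_addr orbT.
- by [].
- by rewrite leq_add2r leq_mul2l -addn1 -addnA leqnn orbT.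
Qed.

(** * The whole algorithm and its running time *)

Definition Deduce := Prepare ;; Setup ;; Forward ;; Find ;; Leaf ;; Cuts ;;
  Flush rO rT ;; Flush rT rZ.

Definition Solve := Deduce ;;
  IfEq rG rA (Push rZ (TBit false)) (Push rZ (TBit true)).

Lemma flatten_nseq_all_items T (f : T -> seq item) cs n :
  flatten (nseq n (all_items f cs)) = all_items f (flatten (nseq n cs)).
Proof. by elim: n => //= n ->; rewrite /all_items map_cat flatten_cat. Qed.

(* The number of rounds of forward chaining is the number of items of [cs],
   which is at least the number of clauses. *)
Definition saturated (cs : seq clause) (g : seq formula) : seq clause :=
  forward g (rev (flatten (nseq (size (all_items citems cs)) cs))).

(** With [m] the number of input items, three stages reach degree five: forward chaining, where
    [m * m] clauses with [m] hypotheses each are tested against about [m * m] known formulas; the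
    [m * m] cuts, on antecedents of cubic length; and the final transfer of the output. The factor
    is generous and absorbs lower terms. *)
Definition op_bound (m : nat) : nat := 200 * m.+1 ^ 5.

Lemma size_items_citems cs : size cs <= size (all_items citems cs).
Proof.
elim: cs => //= c cs IH.
by rewrite /all_items /= size_cat /citems size_cat addn1 addSn ltnS (leq_trans IH) // leq_addl.
Qed.

(** A cut adds its conclusion, bounded as in [size_cut_all], and a leaf with at most [m] hypotheses.
    The 5 counts the two arrows, the two opening brackets and the closing bracket of the leaf. *)
Lemma size_front_cut_all g d cs m :
  size d <= m -> all (fun c : clause => size c.1 <= m) cs ->
  size (front (cut_all g d cs)) <= (size cs).+1 * ((size cs).+1 * m + m + 5).
Proof.
move=> ld; elim: cs => [|c cs IH] /=.
  by move=> _; rewrite size_cat /citems size_cat size_map /=; move: ld; lia.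
move=> /andP[lc hc]; have {}IH := IH hc; have hd := size_cut_all g ld hc.
have [d' [ld' e]] : exists d', size d' <= (size cs).+2 * m /\
    (cut_with g c (cut_all g d cs) = cut_all g d cs \/
     cut_with g c (cut_all g d cs) =
       Node (d', g) [:: Node (rev c.1, c.2) [::]; cut_all g d cs]).
  rewrite /cut_with; case: ifP => _; last by exists [::]; split=> //; left.
  eexists; split; last by right.
  rewrite size_cat mulSn addnC leq_add // (leq_trans _ hd) //.
  by rewrite size_filter count_size.
have aux x n u v : x <= n.+1 * (n.+1 * m + m + 5) -> u <= n.+2 * m -> v <= m ->
  x <= n.+2 * (n.+2 * m + m + 5) /\
  (u + 1 + ((v + 1 + (0 + 1)).+1 + x)).+1 <= n.+2 * (n.+2 * m + m + 5).
  by clear; nia.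
have [a1 a2] := aux _ _ _ _ IH ld' lc.
case: e => -> //; move: a2.
rewrite /= /citems !size_cat /= !size_cat !size_map size_rev /=.
by [].
Qed.

Lemma deduce_time m n p q g fr :
  n <= m * m -> p <= m * m -> q <= m * m -> g <= m ->
  fr <= q.+1 * (q.+1 * m + m + 5) ->
  20 * m.+1 * m.+1 + (3 * g + 2 +
   (n * (m * (10 * (n + g) + 11) + 4 * m + 8) + 1 + (p.+1 * (5 * m + 7) + 1 +
    (7 * m + 5 + (q * (10 * (q.+1 * m) + 8 * m + 21) + 1 +
     (3 * fr + 1 + (3 * fr + 1))))))) <= op_bound m.
Proof.
move=> hn hp hq hg hf; have [M eM] : exists M, M = m.+1 by exists m.+1.
rewrite /op_bound -eM.
have aux x : x <= m * m -> x.+1 <= M * M by rewrite eM; clear; nia.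
have {}hn := aux _ hn; have {}hp := aux _ hp; have {}hq := aux _ hq.
have hm : m <= M by rewrite eM.
have hM : 0 < M by rewrite eM.
have {}hg := leq_trans hg hm.
(* Once every size is replaced by a power of [M], the goal is linear in the monomials, and comparing
   consecutive powers is enough for [lia]. *)
have e2 : M <= M * M by rewrite leq_pmulr.
have e3 : M * M <= M * (M * M) by rewrite leq_pmull.
have e4 : M * (M * M) <= M * (M * (M * M)) by rewrite leq_mul2l leq_pmull ?orbT.
have e5 : M * (M * (M * M)) <= M * (M * (M * (M * M))).
  by rewrite !leq_mul2l leq_pmull ?orbT.
have b1 : n * (m * (10 * (n + g) + 11) + 4 * m + 8) <=
    (M * M) * (M * (10 * (M * M + M) + 11) + 4 * M + 8).
  by rewrite leq_mul ?leq_add ?leq_mul ?leq_add // ltnW.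
have b2 : p.+1 * (5 * m + 7) <= (M * M) * (5 * M + 7).
  by rewrite leq_mul ?leq_add ?leq_mul.
have b3 : q * (10 * (q.+1 * m) + 8 * m + 21) <= (M * M) * (10 * ((M * M) * M) + 8 * M + 21).
  by rewrite leq_mul ?leq_add ?leq_mul ?leq_add // ltnW.
have b4 : fr <= (M * M) * ((M * M) * M + M + 5).
  by apply: leq_trans hf _; rewrite leq_mul ?leq_add ?leq_mul.
rewrite !expnS expn0 muln1; move: e2 e3 e4 e5 b1 b2 b3 b4 hm hM hg; clear; lia.
Qed.

Lemma exec_deduce (xs : seq item) g f1 f2 cs pre b h post :
  filter in_clause xs = all_items citems ((g, Or f1 f2) :: cs) ->
  saturated ((g, Or f1 f2) :: cs) (rev g) = pre ++ (b, h) :: post ->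
  all (fun c : clause => (c.2 != f1) && (c.2 != f2)) pre -> (h == f1) || (h == f2) ->
  let t := cut_all h (rev b) (rev post) in
  exists e, [/\ get e rZ = items_of_tree t,
    get e rG = [:: (TArrow, encode_formula h)],
    get e rA = [:: (TComma, encode_formula f1)] &
    exec Deduce [:: xs; e0; e0; e0; e0; e0; e0; e0; e0; e0; e0; e0; e0] e
      (op_bound (size xs))].
Proof.
move=> hx hs hpre hh t.
set m := size xs; set cls := (g, Or f1 f2) :: cs.
set ws := filter in_clause xs.
have lw : size ws <= m by rewrite size_filter count_size.
(* Each hypothesis of a clause is an item of the input. *)
have lc : all (fun c : clause => size c.1 <= m) cls.
  have : size (all_items citems cls) <= m by rewrite -hx.
  elim: (cls) => //= c l IH; rewrite /all_items /= size_cat => H.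
  rewrite IH ?andbT ?(leq_trans _ H) ?leq_addl //.
  by rewrite (leq_trans _ (leq_addr _ _)) // /citems size_cat size_map leq_addr.
have lg : size g <= m by case/andP: lc.
set tot := flatten (nseq (size ws) cls).
have htot : flatten (nseq (size ws) ws) = all_items citems tot.
  by rewrite {2}/ws hx flatten_nseq_all_items.
have ltot : size tot <= m * m.
  rewrite /tot size_flatten /shape map_nseq sumn_nseq mulnC leq_mul //.
  by rewrite (leq_trans (size_items_citems _)) // -hx.
have atot : all (fun c : clause => size c.1 <= m) tot.
  by apply/allP => c /flattenP[l]; rewrite mem_nseq => /andP[_ /eqP->]; apply: (allP lc).
have hf : forward (rev g) (rev tot) = pre ++ (b, h) :: post.
  by rewrite -hs /saturated -hx.
have sub : {subset pre ++ (b, h) :: post <= tot}.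
  by move=> c; rewrite -hf => /forward_sub; rewrite mem_rev.
have al : all (fun c : clause => size c.1 <= m) (pre ++ (b, h) :: post).
  by apply/allP => c /sub; apply: (allP atot).
have ll : size (pre ++ (b, h) :: post) <= m * m.
  by rewrite -hf (leq_trans (size_forward _ _)) // size_rev.
move: al ll; rewrite all_cat size_cat /= => /and3P[al1 lb al2] ll.
have h1 : exec Prepare [:: xs; e0; e0; e0; e0; e0; e0; e0; e0; e0; e0; e0; e0]
    [:: e0; e0; citems (g, Or f1 f2) ++ all_items citems cs; all_items citems tot;
       e0; e0; e0; e0; e0; e0; e0; e0; e0] (20 * m.+1 * m.+1).
  by have := exec_prepare xs; rewrite /= -/ws htot {1}/ws hx.
have h3 := exec_forward ((TComma, encode_formula f2) :: all_items citems cs)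
  [:: (TComma, encode_formula f1)] (rev g) atot.
rewrite hf in h3.
have lpre : size pre <= m * m by apply: leq_trans ll; apply: leq_addr.
have lpost : size post <= m * m.
  by apply: leq_trans ll; rewrite addnS ltnW // ltnS leq_addl.
have h4 := @exec_find f1 f2 (all_items citems cs)
  (bitems (heads (pre ++ (b, h) :: post) ++ rev g)) pre b h post [::] m hpre hh _ (leq0n m).
have lrb : size (rev b) <= m by rewrite size_rev.
have h6 := exec_cuts _ _ _ h lrb al2.
have lf : size (front t) <= (size post).+1 * ((size post).+1 * m + m + 5).
  by have := @size_front_cut_all h (rev b) (rev post) m lrb; rewrite all_rev size_rev; apply.
(* The final environment is read off from the execution, so the run is proved before the contents of
   its registers. *)
eexists; split; last first.
- apply: exec_le; last first.
    by apply: (deduce_time (n := size tot) (p := size pre) (q := size post)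
      (g := size g) (fr := size (front t))).
  apply: exec_seq; first exact: h1.
  apply: exec_seq; first exact: exec_setup.
  apply: exec_seq; first by rewrite -(size_rev g); exact: h3.
  apply: exec_seq; first by apply: h4; rewrite all_cat al1 /= lb.
  apply: exec_seq.
    by apply: exec_le; [exact: exec_leaf | rewrite size_rev leq_add2r leq_mul2l].
  apply: exec_seq; first exact: h6.
  apply: exec_seq; first by apply: exec_flush.
  rewrite /put /get /= cats0 -(size_rev (front t)).
  exact: exec_flush.
- by [].
- by [].
- by rewrite /put /get /= revK front_closings.
Qed.

(** * Slash and saturation *)

(* [U] is strictly smaller than [V] in general: a disjunct has to be deduced
   from sequents of the derivation, not merely to be a hypothesis. *)
Fixpoint slash (U V : formula -> Prop) (a : formula) : Prop :=
  match a with
  | Atom _ | Bot => True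
  | Or a b => (U a /\ slash U V a) \/ (U b /\ slash U V b)
  | And a b => slash U V a /\ slash U V b
  | Imp a b => V a -> slash U V a -> slash U V b
  end.

(** Among the clauses of [slash] only the one for disjunctions asks for membership in [U], and the
    recursion reaches strictly positive parts only: at an implication it suffices to treat the
    consequent. *)
Lemma harrop_slash U V a : harrop a -> slash U V a.
Proof.
elim: a => //= [a _ b _|a IHa b IHb|a _ b IHb] h.
- by case: (h a b); apply: SP_refl.
- split; [apply: IHa | apply: IHb] => c0 c1 sp; apply: (h c0 c1).
    exact: SP_andl.
  exact: SP_andr.
- by move=> _ _; apply: IHb => c0 c1 sp; apply: (h c0 c1); apply: SP_impr.
Qed.

Definition closed_under (S : seq sequent) (U V : formula -> Prop) : Prop :=
  forall s, s \in S -> (forall a, a \in s.1 -> V a) -> U s.2.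

Lemma root_label A (t : tree A) : exists l, tree_labels t = tree_root t :: l.
Proof. by case: t => x ts /=; eexists. Qed.

Lemma closed_root U V d : closed_under (tree_labels d) U V ->
  (forall a, a \in (tree_root d).1 -> V a) -> U (tree_root d).2.
Proof.
by move=> h; have [l e] := root_label d; apply: h; rewrite e mem_head.
Qed.

Lemma closed_child U V s ts t : closed_under (tree_labels (Node s ts)) U V ->
  List.In t ts -> closed_under (tree_labels t) U V.
Proof.
move=> h ht c hc; apply: h => /=; rewrite inE; apply/orP; right.
elim: ts ht => //= t' ts IH [->|/IH H]; rewrite mem_cat ?hc // H orbT //.
Qed.

(** Closure under the sequents of [d] supplies the membership that introducing a disjunction or
    applying an implication requires: the premise is itself a sequent of [d] whose antecedent lies
    in [V]. The [Bot] axiom is harmless since atoms are always slashed. *)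
Lemma slash_sound U V d : (forall a, U a -> V a) -> NJp d ->
  closed_under (tree_labels d) U V ->
  (forall a, a \in (tree_root d).1 -> V a /\ slash U V a) ->
  slash U V (tree_root d).2.
Proof.
move=> UV; elim=> {d} [G a|G p|G a0 a1 b t t0 t1 _ IH _ IH0 _ IH1 e e0 e1
  |G a0 a1 t _ IH e|G a0 a1 t _ IH e|G a0 a1 t _ IH e|G a0 a1 t _ IH e
  |G a0 a1 t0 t1 _ IH0 _ IH1 e0 e1|G a b t0 t1 _ IH0 _ IH1 e0 e1|G a b t _ IH e] cl /= hG.
- by case: (hG a); rewrite // !inE eqxx.
- by [].
- have ct := closed_child cl (or_introl erefl).
  have ct0 := closed_child cl (or_intror (or_introl erefl)).
  have ct1 := closed_child cl (or_intror (or_intror (or_introl erefl))).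
  (* The slash of the major premise selects a disjunct that is in [U], hence in [V], so the enlarged
     antecedent of the matching minor premise is admissible. *)
  move: (IH ct); rewrite e /= => /(_ hG) [[Ua sa]|[Ua sa]].
  + move: (IH0 ct0); rewrite e0 /=; apply=> c; rewrite !inE => /orP[/eqP->|/hG//].
    by split=> //; apply: UV.
  + move: (IH1 ct1); rewrite e1 /=; apply=> c; rewrite !inE => /orP[/eqP->|/hG//].
    by split=> //; apply: UV.
- have ct := closed_child cl (or_introl erefl); left.
  move: (IH ct) (closed_root ct); rewrite e /= => s u; split; last exact: s.
  by apply: u => c /hG[].
- have ct := closed_child cl (or_introl erefl); right.
  move: (IH ct) (closed_root ct); rewrite e /= => s u; split; last exact: s.
  by apply: u => c /hG[].
- have ct := closed_child cl (or_introl erefl).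
  by move: (IH ct); rewrite e /= => /(_ hG)[].
- have ct := closed_child cl (or_introl erefl).
  by move: (IH ct); rewrite e /= => /(_ hG)[].
- have ct0 := closed_child cl (or_introl erefl).
  have ct1 := closed_child cl (or_intror (or_introl erefl)).
  by move: (IH0 ct0) (IH1 ct1); rewrite e0 e1 /= => s0 s1; split; [apply: s0 | apply: s1].
- have ct0 := closed_child cl (or_introl erefl).
  have ct1 := closed_child cl (or_intror (or_introl erefl)).
  move: (IH0 ct0) (IH1 ct1) (closed_root ct1); rewrite e0 e1 /= => s0 s1 u1.
  by apply: s0 => //; [apply/UV/u1 => c /hG[] | apply: s1].
- have ct := closed_child cl (or_introl erefl).
  move: (IH ct); rewrite e /= => s Va sa; apply: s => c.
  by rewrite !inE => /orP[/eqP->|/hG].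
Qed.

(** * Saturation by rounds *)

Definition saturated_for (cs : seq clause) (g : seq formula) (ls : seq clause) : bool :=
  all (fun c => fires (heads ls ++ g) c ==> (c.2 \in heads ls)) cs.

Section Saturation.
Variable g : seq formula.
Local Notation fire := (fun c ls => if fires (heads ls ++ g) c then c :: ls else ls).

Lemma fires_sub ks ks' c : {subset ks <= ks'} -> fires ks c -> fires ks' c.
Proof. by move=> h /allP H; apply/allP => f /H /h. Qed.

Lemma known_sub ks ks' : {subset ks <= ks'} -> {subset ks ++ g <= ks' ++ g}.
Proof. by move=> h f; rewrite !mem_cat => /orP[/h ->|->]; rewrite ?orbT. Qed.

Lemma heads_fire_sub ls zs : {subset heads ls <= heads (foldr fire ls zs)}.
Proof.
elim: zs => //= z zs IH f /IH h; case: ifP => _ //.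
by rewrite /= inE h orbT.
Qed.

Lemma heads_fire ls zs c : c \in zs -> fires (heads ls ++ g) c ->
  c.2 \in heads (foldr fire ls zs).
Proof.
elim: zs => //= z zs IH; rewrite inE => /orP[/eqP->|hc] hf.
  by rewrite (fires_sub (known_sub (heads_fire_sub zs)) hf) /= mem_head.
by case: ifP => _; rewrite /= ?inE IH ?orbT.
Qed.

(** Further rounds may still lengthen the log, but they only repeat known succedents; saturation
    therefore persists. *)
Lemma heads_saturated ls zs : saturated_for zs g ls ->
  {subset heads (foldr fire ls zs) <= heads ls}.
Proof.
elim: zs => [|z zs IH] /=; first by move=> _ f.
move=> /andP[hz /IH {}IH]; case: ifP => // hf f.
rewrite /= inE => /orP[/eqP->|/IH//].
by apply: (implyP hz); apply: fires_sub hf; apply: known_sub.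
Qed.

Variable cs : seq clause.
Let L n := forward g (rev (flatten (nseq n cs))).

Lemma forward_round n : L n.+1 = foldr fire (L n) (rev cs).
Proof.
by rewrite /L -addn1 nseqD flatten_cat /= cats0 rev_cat /forward foldr_cat.
Qed.

Lemma count_lt (T : eqType) (p q : pred T) (s : seq T) x :
  subpred p q -> x \in s -> q x -> ~~ p x -> count p s < count q s.
Proof.
move=> pq; elim: s => //= y s IH; rewrite inE => /orP[/eqP<-|xs] qx px.
  by rewrite qx (negPf px) /= add1n add0n ltnS sub_count.
by rewrite -addnS leq_add ?IH //; case py: (p y); rewrite // (pq _ py).
Qed.

(** The measure counts clauses, not formulas, whose succedent is logged. If the log is not
    saturated, some clause fires whose succedent is new, and the next round adds it to the count. *)
Lemma rounds_progress n : saturated_for cs g (L n) ||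
  (n <= count (fun c => c.2 \in heads (L n)) cs).
Proof.
elim: n => [|n IH]; first by rewrite orbT.
rewrite forward_round; case hs: (saturated_for cs g (L n)).
  have hs' : saturated_for (rev cs) g (L n) by rewrite /saturated_for all_rev.
  have sub := heads_saturated hs'.
  apply/orP; left; apply/allP => c hc; apply/implyP => hf.
  apply: heads_fire_sub; apply: (implyP (allP hs c hc)).
  by apply: fires_sub hf; apply: known_sub.
move: IH; rewrite hs /= => IH; apply/orP; right.
move/negbT/allPn: hs => [c hc]; rewrite negb_imply => /andP[hf hn].
apply: leq_ltn_trans IH _; apply: (count_lt (x := c)) => //.
- by move=> c'; apply: heads_fire_sub.
- by apply: heads_fire => //; rewrite mem_rev.
Qed.

Lemma rounds_saturate n : size cs <= n -> saturated_for cs g (L n).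
Proof.
move=> hn; have /orP[//|h] := rounds_progress n.
have /eqP : count (fun c => c.2 \in heads (L n)) cs = size cs.
  by apply/eqP; rewrite eqn_leq count_size (leq_trans hn).
rewrite -all_count => /allP H; apply/allP => c hc.
by apply/implyP => _; apply: H.
Qed.

End Saturation.

(** * Correctness of the extracted deduction *)

Fixpoint supported (g : seq formula) (ls : seq clause) : bool :=
  if ls is c :: ls' then fires (heads ls' ++ g) c && supported g ls' else true.

Lemma forward_supported g cs : supported g (forward g cs).
Proof. by elim: cs => //= c cs IH; case: ifP => //= ->. Qed.

(** Invariant of the backward reading: after the entries [p1], everything in the antecedent is
    supported by the older entries [p2]. A cut removes the succedent of the last entry read and
    brings in only hypotheses known before that entry. *)
Lemma cut_all_sub g h d p1 p2 : supported g (p1 ++ p2) ->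
  {subset d <= heads (p1 ++ p2) ++ g} ->
  {subset (tree_root (cut_all h d (rev p1))).1 <= heads p2 ++ g}.
Proof.
elim/last_ind: p1 p2 => [|p1 c IH] p2 //.
rewrite cat_rcons => hs hd; have {hd}IH := IH _ hs hd.
rewrite rev_rcons cut_all_cons /cut_with; set t := cut_all _ _ _ in IH *.
have hc : fires (heads p2 ++ g) c.
  by elim: (p1) hs => [/andP[]|c' p IHp /andP[_ /IHp]].
case: ifP => hin f /=; last first.
  move=> hf; have := IH f hf; rewrite /= inE => /orP[/eqP e|//].
  by rewrite -e hf in hin.
rewrite mem_cat mem_filter => /orP[/andP[ne hf]|hf]; last exact: (allP hc).
by have := IH f hf; rewrite /= inE (negPf ne).
Qed.

Lemma tree_map_root A B (f : A -> B) t : tree_root (tree_map f t) = f (tree_root t).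
Proof. by case: t. Qed.

(** A cut is made only if its formula occurs in the current antecedent, so putting the formula back
    after [remove] gives the right premise again as a set. *)
Lemma cut_all_deduction S h d cs :
  sequent_of (d, h) \in S -> {subset map sequent_of cs <= S} ->
  cut_deduction S (tree_map sequent_of (cut_all h d cs)).
Proof.
move=> hd; elim: cs => [|c cs IH] hs; first exact: CD_leaf.
have {}IH : cut_deduction S (tree_map sequent_of (cut_all h d cs)).
  by apply: IH => s hs'; apply: hs; rewrite /= inE hs' orbT.
rewrite cut_all_cons /cut_with; set t := cut_all h d cs in IH *.
have tr : (tree_root t).2 = h := cut_all_root h d cs.
case: ifP => // hin; set d' := (tree_root t).1.
have -> : tree_map sequent_of (Node (remove c.2 d' ++ c.1, h)
    [:: Node (rev c.1, c.2) [::]; t]) =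
  Node ([fset a in rev c.1] `|` [fset a in remove c.2 d'], h)
    [:: Node (sequent_of (rev c.1, c.2)) [::]; tree_map sequent_of t].
  congr (Node (_, _) _); apply/fsetP => a.
  by rewrite !in_fsetE /= ?inE /= ?mem_cat ?mem_rev orbC.
apply: (@CD_cut _ _ _ c.2) => //.
- apply: CD_leaf; apply: hs; rewrite /= inE; apply/orP; left; apply/eqP.
  by congr (_, _); apply/fsetP => a; rewrite !inE /= mem_rev.
- rewrite tree_map_root /sequent_of tr; congr (_, _); apply/fsetP => a.
  rewrite !inE /= mem_filter; case: (eqVneq a c.2) => [->|] //=.
Qed.

(** * Encodings and the theorem *)

Lemma flat_cat xs ys : flat (xs ++ ys) = flat xs ++ flat ys.
Proof. by rewrite /flat map_cat flatten_cat. Qed.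

Lemma flat_citems c : flat (citems c) = encode_sequent c.
Proof.
rewrite /citems flat_cat /encode_sequent /flat /= cats0; congr (_ ++ _).
by rewrite /bitems -map_comp.
Qed.

Lemma map_in_ext A B (f g : A -> B) s :
  (forall x, List.In x s -> f x = g x) -> map f s = map g s.
Proof.
elim: s => //= x s IH h; rewrite h; last by left.
by rewrite IH // => y ys; apply: h; right.
Qed.

Lemma flat_flatten (xss : seq (seq item)) : flat (flatten xss) = flatten (map flat xss).
Proof. by elim: xss => //= xs xss IH; rewrite flat_cat IH. Qed.

Lemma flat_items_of_tree t : flat (items_of_tree t) = encode_tree t.
Proof.
elim/nested_tree_ind: t => c ts IH /=.
rewrite -cat1s 2!flat_cat flat_citems flat_cat flat_flatten -map_comp.
by rewrite (map_in_ext IH).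
Qed.

(** Encodings and labels are both in preorder, so erasing the brackets leaves the sequents one after
    the other. *)
Lemma filter_in_clause t :
  filter in_clause (items_of_tree t) = all_items citems (tree_labels t).
Proof.
elim/nested_tree_ind: t => c ts IH /=.
rewrite filter_cat /all_items /=; congr (_ ++ _).
  apply/all_filterP; rewrite /citems all_cat /= andbT.
  by apply/allP => i /mapP[f _ ->].
rewrite filter_cat cats0.
elim: ts IH => //= t ts IHts IH; rewrite filter_cat map_cat flatten_cat.
rewrite IHts; last by move=> t' h; apply: IH; right.
by rewrite IH //; left.
Qed.

Lemma tree_labels_map A B (f : A -> B) t :
  tree_labels (tree_map f t) = map f (tree_labels t).
Proof.
elim/nested_tree_ind: t => c ts IH /=; congr (_ :: _).
elim: ts IH => //= t ts IHts IH; rewrite map_cat.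
rewrite IHts; last by move=> t' h; apply: IH; right.
by rewrite IH //; left.
Qed.

Lemma good_flat xs :
  all (fun i : item => delim i.1 && is_word i.2) xs -> all (good (size (flat xs))) xs.
Proof.
move=> /allP h; apply/allP => i hi; have /andP[h1 h2] := h i hi.
rewrite /good h1 h2 /=; elim: xs hi {h} => //= x xs IH.
rewrite inE /flat /= size_cat => /orP[/eqP->|/IH]; first exact/leqW/leq_addr.
by move=> /leq_trans; apply; apply/leqW/leq_addl.
Qed.

Lemma good_items_of_tree t : all (good (size (encode_tree t))) (items_of_tree t).
Proof.
rewrite -flat_items_of_tree; apply: good_flat.
elim/nested_tree_ind: t => c ts IH; rewrite /= !all_cat /= andbT; apply/andP; split.
  rewrite is_word_encode /= andbT.
  by apply/allP => i /mapP[f _ ->]; rewrite /= is_word_encode.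
elim: ts IH => //= t ts IHts IH; rewrite all_cat IH; last by left.
by rewrite IHts // => t' h; apply: IH; right.
Qed.

Lemma size_flat xs : size xs <= size (flat xs).
Proof.
elim: xs => //= x xs IH; rewrite /flat /= ltnS size_cat.
exact: leq_trans IH (leq_addl _ _).
Qed.

(** The answer bit is not a delimiter, so the final first tape is not a list of items, and the last
    instruction is treated below the level of [exec]. The extra time is [7 * N + 8] for the
    comparison and 2 for the push. *)
Lemma trun_solve N xs e T t f h :
  all (good N) xs ->
  exec Deduce [:: xs; e0; e0; e0; e0; e0; e0; e0; e0; e0; e0; e0; e0] e T ->
  get e rZ = items_of_tree t -> get e rG = [:: (TArrow, encode_formula h)] ->
  get e rA = [:: (TComma, encode_formula f)] ->
  exists2 d, trun Solve (initial (flat xs)) d (T * cost N + (7 * N + 10)) &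
    blank_eq (d ord0).2 (cells (TBit (h != f) :: encode_tree t)).
Proof.
move=> gx [H] eZ eG eA.
have ri : rep N (initial (flat xs)) [:: xs; e0; e0; e0; e0; e0; e0; e0; e0; e0; e0; e0; e0].
  by case; do 13?[case=> [? |]] => //= n hn; split.
have [b hb rb] := H N _ ri.
pose b' := canonical (fun j => (b j).1) e.
have eb : ceq b b' by move=> j; case: (hb j).
have [_] := hb rG; rewrite eG /= andbT => /and3P[_ _ lh].
pose d := upd b' rZ (behead (b' rZ).1, Some (inl (TBit (h != f))) :: (b' rZ).2).
exists d; last first.
  by rewrite /d /upd /= /b' /canonical eZ flat_items_of_tree.
apply: trun_seq rb _; apply: trun_weak eb (ceq_refl d) _.
  apply: (@trun_ifeq rG rA (b rG).1 (b rA).1 TArrow TComma (encode_formula h)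
    (encode_formula f) [::] [::] _ _ b' d 2) => //; rewrite ?is_word_encode //.
  - by rewrite /b' /canonical eG cells_flat_cons.
  - by rewrite /b' /canonical eA cells_flat_cons.
  - rewrite (inj_eq encode_inj) /d; case: (h == f); exact: trun_push.
by rewrite -addnA leq_add2r leq_mul2l.
Qed.

Lemma split_first (T : Type) (p : pred T) s :
  has p s -> exists pre x post, [/\ s = pre ++ x :: post, p x & all (predC p) pre].
Proof.
elim: s => //= x s IH; case px: (p x) => /=; first by exists [::], x, s.
by move=> /IH[pre [y [post [-> py h]]]]; exists (x :: pre), y, post; rewrite /= px.
Qed.

(** The product of the factors 200 of [op_bound] and 20 of [cost] is 4000; the remaining 20 covers
    the final comparison and the answer bit. *)
Definition time_poly : {poly nat} := (4020%:R * ('X + 1) ^+ 6)%R.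

Lemma time_polyE N : time_poly.[N]%R = 4020 * N.+1 ^ 6.
Proof.
rewrite /time_poly -polyC_natr hornerCM horner_exp hornerD hornerX hornerC.
rewrite natrXE natn.
by have -> : (N + 1)%R = N.+1 by rewrite -[RHS]addn1.
Qed.

Lemma solve_time m N : m <= N -> op_bound m * cost N + (7 * N + 10) <= time_poly.[N]%R.
Proof.
move=> mN; rewrite time_polyE /op_bound /cost [N.+1 ^ 6]expnSr.
have h : m.+1 ^ 5 <= N.+1 ^ 5 by rewrite leq_exp2r.
have h' : N.+1 <= N.+1 ^ 5 * N.+1 by rewrite leq_pmull ?expn_gt0.
have : m.+1 ^ 5 * N.+1 <= N.+1 ^ 5 * N.+1 by rewrite leq_mul2r h orbT.
have -> : 200 * m.+1 ^ 5 * (20 * N.+1) = 4000 * (m.+1 ^ 5 * N.+1).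
  by rewrite mulnACA.
move: (m.+1 ^ 5 * _) (N.+1 ^ 5 * _) h' => x y; clear; lia.
Qed.

Local Open Scope fset_scope.

Theorem theorem3p6 :
  exists (M : turing_machine token) (p : {poly nat}),
  forall (d : tree sequent) (G : cedent) (a0 a1 : formula) (w : seq token),
    NJp d -> tree_root d = (G, Or a0 a1) -> harrop_cedent G ->
    tree_encoding d w ->
    exists (i : bool) (t : tree sequent) (G' : cedent) (v : seq token),
      [/\ tm_computes_within M w v p.[size w]%R,
          answer_encoding i t v,
          cut_deduction (tree_labels d) t,
          tree_root t = (G', if i then a1 else a0)
        & G' `<=` G].
Proof.
exists (turing_of Solve), time_poly.
move=> d G a0 a1 w hd hr hG [u ud wE].
have [[g a] ru] : {s | tree_root u = s} by exists (tree_root u).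
have [eG ea] : [fset f in g] = G /\ a = Or a0 a1.
  by move: hr; rewrite -ud tree_map_root ru => -[].
rewrite {}ea in ru.
have [cs ecs] := root_label u; rewrite ru in ecs.
have ld : tree_labels d = map sequent_of (tree_labels u) by rewrite -ud tree_labels_map.
pose ls := saturated (tree_labels u) (rev g).
have sat : saturated_for (tree_labels u) (rev g) ls.
  by apply: rounds_saturate; apply: size_items_citems.
(* The slash is taken over the log actually computed, so membership in [U] already names a sequent
   from which the deduction can be extracted. *)
pose U f := f \in heads ls; pose V f := f \in heads ls ++ rev g.
have cl : closed_under (tree_labels d) U V.
  rewrite ld => s /mapP[c hc ->] h /=.
  apply: (implyP (allP sat c hc)); apply/allP => f hf.
  by apply: h; rewrite !inE.
have sl : slash U V (Or a0 a1).
  have := slash_sound _ hd cl; rewrite hr; apply.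
    by move=> f; rewrite /U /V mem_cat => ->.
  move=> f hf; split; last exact/harrop_slash/hG.
  by move: hf; rewrite -eG !inE /V mem_cat mem_rev orbC => ->.
have hls : has (fun c : clause => (c.2 == a0) || (c.2 == a1)) ls.
  by case: sl => [[/mapP[c hc e] _]|[/mapP[c hc e] _]]; apply/hasP; exists c;
    rewrite // -e eqxx ?orbT.
have [pre [[b h] [post [els hh hpre]]]] := split_first hls.
have hpre' : all (fun c : clause => (c.2 != a0) && (c.2 != a1)) pre.
  by apply: sub_all hpre => c /=; rewrite negb_or.
have sub : {subset ls <= tree_labels u}.
  move=> c /forward_sub; rewrite mem_rev => /flattenP[l].
  by rewrite mem_nseq => /andP[_ /eqP->].
have sup : supported (rev g) ls := forward_supported _ _.
have [e [eZ eG' eA hexec]] := @exec_deduce (items_of_tree u) g a0 a1 cs pre b h post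
  (etrans (filter_in_clause u) (congr1 _ ecs)) (etrans (congr1 (saturated^~ _) (esym ecs)) els)
  hpre' hh.
set t := cut_all h (rev b) (rev post) in eZ.
have gw : all (good (size w)) (items_of_tree u) by rewrite wE good_items_of_tree.
have [c rc hc] := trun_solve gw hexec eZ eG' eA.
exists (h != a0), (tree_map sequent_of t), [fset f in (tree_root t).1],
  (TBit (h != a0) :: encode_tree t); split.
- apply: turing_of_computes hc.
  have lw : size (items_of_tree u) <= size w by rewrite wE -flat_items_of_tree size_flat.
  by apply: trun_weak rc _ _ _; rewrite ?wE ?flat_items_of_tree -?wE // solve_time.
- by exists (encode_tree t) => //; exists t.
- apply: cut_all_deduction.
    rewrite ld; apply/mapP; exists (b, h); first by apply: sub; rewrite els mem_cat mem_head orbT.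
    by congr (_, _); apply/fsetP => f; rewrite !inE /= mem_rev.
  move=> s /mapP[c' hc' ->]; rewrite ld; apply: map_f; apply: sub.
  by rewrite els mem_cat inE -(mem_rev post) hc' !orbT.
- rewrite tree_map_root /sequent_of cut_all_root; congr (_, _).
  by case: (eqVneq h a0) hh => [->|] //= _ /eqP.
- apply/fsubsetP => f; rewrite -eG !inE /= => hf.
  have sup' : supported (rev g) ((b, h) :: post).
    by move: sup; rewrite els; elim: (pre) => //= c' l IH /andP[_ /IH].
  case/andP: sup' => hb sup'.
  (* With no older entries left, only hypotheses of the end sequent can support the antecedent. *)
  have := @cut_all_sub (rev g) h (rev b) post [::]; rewrite cats0 => /(_ sup') H.
  by rewrite -mem_rev; apply: H hf => f'; rewrite mem_rev => /(allP hb).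
Qed.
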